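(* Let $H$ be a digital $2$-manifold. Suppose that for every digital $2$-manifold $K$ equivalent to $H$ (including $K=H$), any digital $1$-sphere $S$ belonging to $K$ is the boundary of some digital $2$-disk $D$ belonging to $K$. Then $H$ is a digital $2$-sphere.
   Context: A digital space is a finite simple undirected graph, its vertices are called points; a subspace is an induced subgraph, and a sphere or disk ''belongs to'' $K$ if it is an induced subgraph of $K$. For a point $v$, the rim $O(v)$ is the subspace induced on the neighbours of $v$; $O(v,u)=O(v)\cap O(u)$. The family $T$ of contractible graphs is defined inductively: the one-point graph $K(1)$ belongs to $T$, and $T$ consists of all graphs obtained from $K(1)$ by finite sequences of the following contractible transformations: deleting a point $v$ with $O(v)\in T$; adding a new point $v$ so that its rim is an induced subgraph $H\in T$; deleting an edge $(v,u)$ with $O(v,u)\in T$; adding an edge between non-adjacent points $v,u$ with $O(v,u)\in T$. A digital $0$-disk is a single point; a digital $0$-sphere is the graph consisting of two non-adjacent points. A digital $1$-sphere is a connected graph in which the rim of every point is a $0$-sphere; a digital $1$-disk is a $1$-sphere with one point deleted (its boundary is the pair of endpoints). For $n=2$: a digital $2$-disk is a connected contractible graph $D$ that is a disjoint union $D=\partial D\cup\mathrm{Int}D$ of two nonempty subspaces such that the rim (in $D$) of each point of $\partial D$ is a digital $1$-disk, the rim of each point of $\mathrm{Int}D$ is a digital $1$-sphere, and the boundary $\partial D$ is a digital $1$-sphere; a digital $2$-sphere is a graph $D\#C$ obtained from two digital $2$-disks $D,C$ with isomorphic boundaries by identifying each point of $\partial D$ with its counterpart in $\partial C$. A digital $2$-manifold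 is a connected graph in which the rim of every point is a digital $1$-sphere. d-Transformations of a digital $2$-manifold $N$: (i) if $D$ is a digital $2$-disk belonging to $N$ and $v\in\mathrm{Int}D$, delete all points of $\mathrm{Int}D$ except $v$ and join $v$ to every point of $\partial D$; (ii) if $v$ is a point of $N$ and $D$ is a digital $2$-disk disjoint from $N$ with $\partial D$ isomorphic to $O(v)$, identify each point of $\partial D$ with its counterpart in $O(v)$ and delete $v$. Two digital $2$-manifolds are equivalent if one can be obtained from the other by a sequence of d-transformations. *)

(* Defs.v *)
From mathcomp Require Import all_boot.
Set Implicit Arguments.
Unset Strict Implicit.
Unset Printing Implicit Defensive.

Record graph := Graph {
  vertex :> finType;
  edge : rel vertex;
  edge_sym : symmetric edge;
  edge_irr : irreflexive edge }.

Arguments edge {g} : rename.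

Definition is_iso (G H : graph) (f : G -> H) : Prop :=
  bijective f /\ forall x y : G, edge (f x) (f y) = edge x y.

Definition iso (G H : graph) : Prop := exists f : G -> H, is_iso f.

(* A connected graph is required to be nonempty. *)
Definition connected (G : graph) : Prop :=
  0 < #|{: G}| /\ forall x y : G, connect edge x y.

Section Constructions.
Variable G : graph.

Definition induced_edge (A : {set G}) (x y : {z : G | z \in A}) : bool :=
  edge (val x) (val y).

Lemma induced_sym A : symmetric (@induced_edge A).
Proof. by move=> x y; apply: edge_sym. Qed.

Lemma induced_irr A : irreflexive (@induced_edge A).
Proof. by move=> x; apply: edge_irr. Qed.

Definition induced (A : {set G}) : graph :=
  @Graph {z : G | z \in A} (@induced_edge A) (@induced_sym A) (@induced_irr A).

Definition nbhd (v : G) : {set G} := [set u | edge v u].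

Definition rim (v : G) : graph := induced (nbhd v).

Definition rim2 (v u : G) : graph := induced (nbhd v :&: nbhd u).

Definition del_vertex (v : G) : graph := induced [set~ v].

(* The new vertex is [None]; its rim is (a copy of) the subgraph induced on A. *)
Definition add_vertex_edge (A : {set G}) (p q : option G) : bool :=
  match p, q with
  | Some x, Some y => edge x y
  | Some x, None => x \in A
  | None, Some y => y \in A
  | None, None => false
  end.

Lemma add_vertex_sym A : symmetric (add_vertex_edge A).
Proof. by move=> [x|] [y|] //=; apply: edge_sym. Qed.

Lemma add_vertex_irr A : irreflexive (add_vertex_edge A).
Proof. by move=> [x|] //=; apply: edge_irr. Qed.

Definition add_vertex (A : {set G}) : graph :=
  @Graph (option G) (add_vertex_edge A) (add_vertex_sym A) (add_vertex_irr A).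

Definition del_edge_rel (v u x y : G) : bool :=
  edge x y && ([set x; y] != [set v; u]).

Lemma del_edge_sym v u : symmetric (del_edge_rel v u).
Proof. by move=> x y; rewrite /del_edge_rel edge_sym setUC. Qed.

Lemma del_edge_irr v u : irreflexive (del_edge_rel v u).
Proof. by move=> x; rewrite /del_edge_rel edge_irr. Qed.

Definition del_edge (v u : G) : graph :=
  Graph (del_edge_sym v u) (del_edge_irr v u).

(* Joins v to every point of A (other than v itself). *)
Definition join_edge (v : G) (A : {set G}) (x y : G) : bool :=
  edge x y ||
  (x != y) && ((x == v) && (y \in A) || (y == v) && (x \in A)).

Lemma join_sym v A : symmetric (join_edge v A).
Proof. by move=> x y; rewrite /join_edge edge_sym (eq_sym x) [X in _ && X]orbC. Qed.

Lemma join_irr v A : irreflexive (join_edge v A).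
Proof. by move=> x; rewrite /join_edge edge_irr eqxx. Qed.

Definition join (v : G) (A : {set G}) : graph :=
  Graph (join_sym v A) (join_irr v A).

End Constructions.

(* The family T; closed under isomorphism, since constructed vertices are not
   canonical. *)
Inductive contractible : graph -> Prop :=
| contractible_K1 (G : graph) : #|{: G}| = 1 -> contractible G
| contractible_iso (G H : graph) : iso G H -> contractible G -> contractible H
| contractible_del_vertex (G : graph) (v : G) :
    contractible G -> contractible (rim v) -> contractible (del_vertex v)
| contractible_add_vertex (G : graph) (A : {set G}) :
    contractible G -> contractible (induced A) -> contractible (add_vertex A)
| contractible_del_edge (G : graph) (v u : G) :
    edge v u -> contractible G -> contractible (rim2 v u) ->
    contractible (del_edge v u)
| contractible_add_edge (G : graph) (v u : G) :
    v != u -> ~~ edge v u -> contractible G -> contractible (rim2 v u) ->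
    contractible (join v [set u]).

(* Identification of two disjoint graphs G and H along an isomorphism g from
   the subgraph of H induced on B to the subgraph of G induced on A: each b in
   B is represented by its counterpart g b in A. *)
Section Glue.
Variables (G H : graph) (A : {set G}) (B : {set H}) (g : induced B -> induced A).

Definition glue_edge (p q : G + {y : H | y \notin B}) : bool :=
  match p, q with
  | inl x, inl x' => edge x x'
  | inr y, inr y' => edge (val y) (val y')
  | inl x, inr y | inr y, inl x =>
      [exists b : induced B, (val (g b) == x) && edge (val b) (val y)]
  end.

Lemma glue_sym : symmetric glue_edge.
Proof. by move=> [x|y] [x'|y'] //=; apply: edge_sym. Qed.

Lemma glue_irr : irreflexive glue_edge.
Proof. by move=> [x|y] /=; apply: edge_irr. Qed.

Definition glue : graph :=
  @Graph (G + {y : H | y \notin B})%type glue_edge glue_sym glue_irr.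

End Glue.

Definition sphere0 (G : graph) : Prop :=
  #|{: G}| = 2 /\ forall x y : G, ~~ edge x y.

Definition sphere1 (G : graph) : Prop :=
  connected G /\ forall v : G, sphere0 (rim v).

Definition disk1 (G : graph) : Prop :=
  exists (S : graph) (p : S), sphere1 S /\ iso (del_vertex p) G.

(* D is a digital 2-disk with boundary B and interior ~: B. *)
Definition disk2 (D : graph) (B : {set D}) : Prop :=
  [/\ connected D,
      contractible D,
      B != set0 /\ ~: B != set0,
      (forall x : D, x \in B -> disk1 (rim x)) /\
      (forall x : D, x \in ~: B -> sphere1 (rim x))
    & sphere1 (induced B)].

Definition sphere2 (G : graph) : Prop :=
  exists (D C : graph) (BD : {set D}) (BC : {set C})
         (g : induced BC -> induced BD),
    [/\ disk2 BD, disk2 BC, is_iso g & iso (glue g) G].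

Definition manifold2 (G : graph) : Prop :=
  connected G /\ forall v : G, sphere1 (rim v).

(* A set of points of a subspace, as a set of points of the ambient space. *)
Definition ambient (G : graph) (D : {set G}) (B : {set induced D}) : {set G} :=
  [set val x | x in B].

Definition shrink_disk (N : graph) (D : {set N}) (B : {set induced D}) (v : N)
    : graph :=
  @induced (join v (ambient B)) (~: (ambient (~: B) :\ v)).

Definition replace_point (N : graph) (v : N) (D : graph) (B : {set D})
    (g : induced B -> rim v) : graph :=
  @del_vertex (glue g) (inl v).

Inductive d_transform (N : graph) : graph -> Prop :=
| d_shrink (D : {set N}) (B : {set induced D}) (v : N) :
    manifold2 N -> disk2 B -> v \in ambient (~: B) ->
    d_transform N (shrink_disk B v)
| d_replace (v : N) (D : graph) (B : {set D}) (g : induced B -> rim v) :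
    manifold2 N -> disk2 B -> is_iso g ->
    d_transform N (replace_point g).

Inductive obtainable (N : graph) : graph -> Prop :=
| obtainable_iso (M : graph) : iso N M -> obtainable N M
| obtainable_step (K L M : graph) :
    obtainable N K -> d_transform K L -> iso L M -> obtainable N M.

Definition equivalent (N M : graph) : Prop :=
  obtainable N M \/ obtainable M N.

(* Main.v *)
(* Shrink disks with at least two interior points as long as possible. If no
   such disk is left in K, every induced circle bounds a one-point disk, hence is
   the rim of a point, and every edge lies in an induced square, since otherwise
   the union of the balls of its ends would be a disk with two interior points.
   These squares are rims as well, which forces two distinct points v and y with
   the same rim; then K is the suspension of that rim and K - v is a cone, hence
   contractible. In a 2-manifold, K - x is contractible for one x iff it is for
   all x, because a circle minus a point is contractible. Going back through a
   shrinking K -> K' of a disk D, K - w is contractible as soon as K' - w is, for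
   w outside D: coning off the contractible D and then removing its interior are
   contractible transformations. So H - w is contractible, and H is the union of
   the two disks H - w and the ball of w. *)
Require Import Defs.
From mathcomp Require Import all_boot.
From Stdlib Require Import Classical_Prop.

Set Implicit Arguments.
Unset Strict Implicit.
Unset Printing Implicit Defensive.

(** * Contractible induced subgraphs *)

Lemma inj_surj_bij (T T' : finType) (f : T -> T') :
  injective f -> (forall y, exists x, f x = y) -> bijective f.
Proof.
move=> f_inj f_surj; apply: inj_card_bij => //.
rewrite -(card_codom f_inj); apply: subset_leq_card; apply/subsetP=> y _.
by have [x <-] := f_surj y; apply: codom_f.
Qed.

Lemma iso_sym (G H : graph) : iso G H -> iso H G.
Proof.
move=> [f [[g fK gK] fE]]; exists g; split; first by exists f.
by move=> x y; rewrite -fE !gK.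
Qed.

Lemma iso_trans (G H K : graph) : iso G H -> iso H K -> iso G K.
Proof.
move=> [f [bf fE]] [g [bg gE]]; exists (g \o f); split; first exact: bij_comp.
by move=> x y /=; rewrite gE fE.
Qed.

Lemma iso_onto (G H : graph) (f : G -> H) (A : {set H}) :
    injective f -> (forall x y, edge (f x) (f y) = edge x y) ->
    f @: setT = A ->
  iso G (induced A).
Proof.
move=> f_inj fE fA.
have fP x : f x \in A by rewrite -fA imset_f.
exists (fun x => exist _ (f x) (fP x) : induced A); split=> //.
apply: inj_surj_bij => [x y /(congr1 val) /= /f_inj // | [y yA]].
have [x _ fx] : exists2 x, x \in setT & y = f x by apply/imsetP; rewrite fA.
by exists x; apply/val_inj.
Qed.

Lemma imset_val (T : finType) (A : {set T}) :
  [set val x | x in [set: {x : T | x \in A}]] = A.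
Proof.
apply/setP=> y; apply/imsetP/idP => [[x _ ->] | yA]; first exact: (valP x).
by exists (exist _ y yA).
Qed.

(** Only points of [A] are constrained, so the identity between two graphs on the same points is an
    embedding wherever their edges agree. This is how [K] is compared with [join v B]. *)
Definition emb (G H : graph) (f : G -> H) (A : {set G}) : Prop :=
  {in A &, injective f} /\ {in A &, forall x y, edge (f x) (f y) = edge x y}.

Lemma emb_iso (G H : graph) (f : G -> H) (A : {set G}) :
  emb f A -> iso (induced A) (induced (f @: A)).
Proof.
move=> [f_inj fE]; apply: (@iso_onto _ _ (fun x : induced A => f (val x))).
- by move=> x y /f_inj e; apply/val_inj/e; apply: valP.
- by move=> x y; rewrite fE //; apply: valP.
by rewrite (imset_comp f val) imset_val.
Qed.

Lemma emb_val (G : graph) (D : {set G}) (A : {set induced D}) :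
  emb (val : induced D -> G) A.
Proof. by split=> // x y _ _ /val_inj. Qed.

Lemma induced_ambient (G : graph) (D : {set G}) (A : {set induced D}) :
  iso (induced A) (induced (ambient A)).
Proof. exact: (emb_iso (emb_val A)). Qed.

Notation CT A := (contractible (induced A)).

Lemma CT_emb (G H : graph) (f : G -> H) (A : {set G}) :
  emb f A -> CT A <-> CT (f @: A).
Proof.
move=> /emb_iso fA; split; first exact: contractible_iso.
exact/contractible_iso/iso_sym.
Qed.

Lemma CT_ambient (G : graph) (D : {set G}) (A : {set induced D}) :
  CT A <-> CT (ambient A).
Proof. exact: (CT_emb (emb_val A)). Qed.

Section Induced.
Variable G : graph.
Implicit Types (x y z a b : G) (A B X Y : {set G}).

Lemma edgeC x y : edge x y = edge y x. Proof. exact: edge_sym. Qed.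

Lemma edge_neq x y : edge x y -> x != y.
Proof. by apply: contraTneq => ->; rewrite edge_irr. Qed.

Lemma in_nbhd x y : (y \in nbhd x) = edge x y.
Proof. by rewrite inE. Qed.

(** The moves of the family T act on whole graphs; here and in [CT_del] they become operations on
    subsets of one fixed graph. *)
Lemma CT_add x A : x \notin A -> CT A -> CT (A :&: nbhd x) -> CT (x |: A).
Proof.
move=> xA cA cR.
pose R := [set y : induced A | edge x (val y)].
have cR' : CT R.
  apply/CT_ambient; suff -> : ambient R = A :&: nbhd x by [].
  apply/setP=> y; apply/imsetP/idP => [[[z zA]]|].
    by rewrite !inE /= => ? ->; rewrite zA.
  by rewrite !inE => /andP[yA xy]; exists (exist _ y yA); rewrite ?inE.
apply: contractible_iso (contractible_add_vertex cA cR').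
pose f (p : add_vertex R) : G := if p is Some y then val y else x.
apply: (iso_onto (f := f)) => [[y|] [z|] //= | [y|] [z|] //= |].
- by move=> /val_inj ->.
- by move=> e; move: xA; rewrite -e (valP y).
- by move=> e; move: xA; rewrite e (valP z).
- by rewrite inE edgeC.
- by rewrite inE.
- by rewrite edge_irr.
apply/setP=> y; rewrite !inE; apply/imsetP/orP => [[[z|] _ ->]|[/eqP->|yA]].
- by right; apply: (valP z).
- by left.
- by exists None.
- by exists (Some (exist _ y yA)).
Qed.

Lemma ambient_nbhd A (x : induced A) : ambient (nbhd x) = A :&: nbhd (val x).
Proof.
apply/setP=> y; apply/imsetP/idP => [[z]|].
  by rewrite !inE => ? ->; apply/andP; split; first exact: (valP z).
by rewrite !inE => /andP[yA xy]; exists (exist _ y yA); rewrite ?inE.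
Qed.

Lemma ambient_del A (x : induced A) : ambient [set~ x] = A :\ val x.
Proof.
apply/setP=> y; apply/imsetP/idP => [[z]|].
  by rewrite !inE => zx ->; apply/andP; split; last exact: (valP z).
by rewrite !inE => /andP[yx yA]; exists (exist _ y yA); rewrite ?inE.
Qed.

Lemma CT_del x A : x \in A -> CT A -> CT (A :&: nbhd x) -> CT (A :\ x).
Proof.
move=> xA cA cR; pose x' : induced A := exist _ x xA.
rewrite -[x]/(val x') -ambient_del; apply/CT_ambient.
by apply: contractible_del_vertex => //; apply/CT_ambient; rewrite ambient_nbhd.
Qed.

Lemma CT_set1 x : CT [set x].
Proof. by apply: contractible_K1; rewrite card_sig cards1. Qed.

(** Induction on the size of [A]: a point other than the apex [v] has, as its rim in the rest, a
    smaller cone with the same apex. *)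
Lemma CT_cone v A :
  v \in A -> (forall x, x \in A -> x != v -> edge v x) -> CT A.
Proof.
have [n] := ubnP #|A|; elim: n A => // n IH A ltAn vA vE.
have [->|] := eqVneq A [set v]; first exact: CT_set1.
rewrite eqEsubset sub1set vA andbT => /subsetPn[x xA]; rewrite inE => xv.
rewrite -(setD1K xA).
have cardA : #|A :\ x| < n by rewrite (cardsD1 x) xA in ltAn.
apply: CT_add; first by rewrite !inE eqxx.
- apply: IH => //; first by rewrite !inE vA eq_sym xv.
  by move=> y; rewrite !inE => /andP[_ yA]; apply: vE.
- apply: IH.
  + by apply: leq_ltn_trans cardA; rewrite subset_leq_card // subsetIl.
  + by rewrite !inE vA eq_sym xv edgeC vE.
  + by move=> y; rewrite !inE => /andP[/andP[_ yA] _]; apply: vE.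
Qed.

End Induced.

Lemma emb_Some (G : graph) (R A : {set G}) :
  emb (Some : G -> add_vertex R) A.
Proof. by split=> // x y _ _ []. Qed.

(* Coning X off by a new vertex is a contractible transformation when X is
   contractible; afterwards every point of X outside Y has a cone as its rim,
   so it may be added or removed freely. *)
Lemma CT_glue (G : graph) (X Y : {set G}) :
    (forall x y, x \in X -> x \notin Y -> y \in Y -> y \notin X ->
       ~~ edge x y) ->
    CT X -> CT (None |: Some @: Y : {set add_vertex X}) ->
  CT (X :|: Y).
Proof.
move=> sep cX cY; pose M := add_vertex X.
have ext (s : seq G) : {subset s <= X} ->
    CT (None |: Some @: (Y :|: [set x in s]) : {set M}).
  elim: s => [_|x s IH sX].
    suff -> : Y :|: [set x in [::]] = Y by [].
    by apply/setP=> y; rewrite !inE orbF.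
  have sX' : {subset s <= X} by move=> y ys; apply: sX; rewrite inE ys orbT.
  have xX : x \in X by apply: sX; rewrite inE eqxx.
  have {IH}cs := IH sX'.
  have -> : Y :|: [set y in x :: s] = x |: (Y :|: [set y in s]).
    by apply/setP=> y; rewrite !inE orbCA.
  have [xY|xY] := boolP (x \in Y :|: [set y in s]).
    suff -> : x |: (Y :|: [set y in s]) = Y :|: [set y in s] by [].
    by apply/setUidPr; rewrite sub1set.
  rewrite imsetU1 setUCA; apply: CT_add => //.
    by rewrite in_setU1 /= mem_imset //; apply: Some_inj.
  apply: (@CT_cone M None); first by rewrite !inE /= xX.
  move=> [y|//] + _; rewrite !inE /= mem_imset; last exact: Some_inj.
  move=> /andP[]; rewrite !inE => /orP[yY|/sX' //] xy.
  apply: contraLR xy => yX; apply: sep => //.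
  by move: xY; rewrite !inE negb_or => /andP[].
(* Once all of [X] is present, the rim of [None] is a copy of [X], contractible by hypothesis, so
   [None] can be deleted. *)
have /ext/(@CT_del M None) : {subset enum X <= X}.
  by move=> x; rewrite mem_enum.
have -> : Y :|: [set x in enum X] = X :|: Y.
  by apply/setP=> y; rewrite !inE mem_enum orbC.
rewrite !inE eqxx => /(_ isT).
have -> : (None |: Some @: (X :|: Y)) :&: nbhd (None : M) = Some @: X.
  apply/setP=> -[y|]; rewrite !inE /=; last by symmetry; apply/imsetP=> -[].
  rewrite !mem_imset ?inE; [|exact: Some_inj|exact: Some_inj].
  by case: (y \in X); rewrite ?andbF.
move=> /(_ ((CT_emb (emb_Some X X)).1 cX)) c.
apply/(CT_emb (emb_Some X _)).
suff <- : (None |: Some @: (X :|: Y)) :\ None = Some @: (X :|: Y) by [].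
by rewrite setU1K //; apply/imsetP=> -[].
Qed.

(** * Circles and paths *)

Section Circles.
Variable G : graph.
Implicit Types (x y z a b : G) (A B : {set G}).

(** Connectedness as an induction principle: a property that holds somewhere in [A] and spreads
    along its edges holds throughout, without any path being built. *)
Definition conn A : Prop :=
  forall (X : pred G) x, x \in A -> X x ->
    (forall y z, y \in A -> z \in A -> X y -> edge y z -> X z) ->
  {in A, forall y, X y}.

(** The rim of [x] within [A] is the 0-sphere with points [a] and [b]. *)
Definition nbr_pair A x a b : Prop :=
  [/\ a \in A /\ b \in A, a != b, ~~ edge a b, edge x a /\ edge x b
    & forall c, c \in A -> edge x c -> c = a \/ c = b].

(** A digital 1-sphere as a set of points of an ambient graph; [sphere1_induced] is the link to
    [sphere1]. *)
Definition circle A : Prop :=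
  [/\ exists x, x \in A, conn A
    & forall x, x \in A -> exists a b, nbr_pair A x a b].

Definition pendant A x : Prop :=
  exists a, [/\ a \in A, edge x a & forall c, c \in A -> edge x c -> c = a].

Lemma nbr_pairC A x a b : nbr_pair A x a b -> nbr_pair A x b a.
Proof.
move=> [[aA bA] ab nab [xa xb] H]; split=> //; rewrite 1?eq_sym 1?edgeC //.
by move=> c cA /(H _ cA)[]; [right | left].
Qed.

Lemma nbr_pair_at A x y : circle A -> x \in A -> y \in A -> edge x y ->
  exists z, nbr_pair A x y z.
Proof.
move=> [_ _ cA] xA yA xy; have [a [b ab]] := cA x xA.
have [_ _ _ _ /(_ _ yA xy)[->|->]] := ab; first by exists b.
by exists a; apply: nbr_pairC.
Qed.

Lemma conn_star v A :
  (forall x, x \in A -> x != v -> edge v x) -> v \in A -> conn A.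
Proof.
move=> vA vv X x xA Xx XE y yA.
have Xv : X v.
  by have [<- //|xv] := eqVneq x v; apply: (XE x) => //; rewrite edgeC vA.
by have [-> //|yv] := eqVneq y v; apply: (XE v) => //; apply: vA.
Qed.

Lemma connU A B x : x \in A -> x \in B -> conn A -> conn B -> conn (A :|: B).
Proof.
move=> xA xB cA cB X y yAB Xy XE.
have XA z : z \in A -> X z -> {in A, forall t, X t}.
  move=> zA Xz; apply: (cA X z zA Xz) => s t sA tA.
  by apply: XE; rewrite inE ?sA ?tA.
have XB z : z \in B -> X z -> {in B, forall t, X t}.
  move=> zB Xz; apply: (cB X z zB Xz) => s t sB tB.
  by apply: XE; rewrite inE ?sB ?tB orbT.
have Xx : X x by move: yAB; rewrite inE => /orP[/XA|/XB]; apply.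
by move=> z; rewrite inE => /orP[]; [apply: (XA x)|apply: (XB x)].
Qed.

(** A point of [A] has only two neighbours in [B], and both are already in [A]; so no edge of the
    connected set [B] leaves [A]. This recognises a whole rim from a cycle found inside it. *)
Lemma circle_minimal A B x : circle B -> A \subset B -> x \in A ->
    (forall y, y \in A ->
       exists a b, [/\ a \in A, b \in A, a != b, edge y a & edge y b]) ->
  A = B.
Proof.
move=> [_ cB tB] /subsetP AB xA tA; apply/eqP.
rewrite eqEsubset; apply/andP; split; apply/subsetP => // y.
apply: (cB (mem A) x) => //=; first exact: AB.
move=> {}y z /tB[a [b [_ _ _ _ H]]] zB yA yz.
have [c [d [cA dA cd yc yd]]] := tA y yA.
have := H _ zB yz; have := H _ (AB _ cA) yc; have := H _ (AB _ dA) yd.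
by move=> []? []? []?; subst => //; rewrite eqxx in cd.
Qed.

(* The arc grows from a neighbour of the removed point p, one end at a time. *)
Lemma circle_arc A p : circle A -> p \in A -> CT (A :\ p) /\ conn (A :\ p).
Proof.
move=> cA pA; have [_ kA tA] := cA; have [a [a' [[aA a'A] aa' _ [pa pa'] pE]]] := tA p pA.
(* [X] is an arc that starts at [a] and ends at [e], and [f] is the next point: apart from the edge
   [e f], edges from [X] to the rest of [A] lead to [p]. The number [n] bounds the points of [A] not
   yet reached. *)
suff grow n : forall (X : {set G}) (e f : G), #|A :\: X| < n ->
    X \subset A -> p \notin X -> CT X -> conn X -> a \in X -> e \in X ->
    f \in A -> f \notin X -> f != p -> edge e f ->
    (forall x z, x \in X -> z \in A -> edge x z ->
       (z \in X) || (z == p) || (x == e) && (z == f)) ->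
  CT (A :\ p) /\ conn (A :\ p).
  have [f [[_ fA] pf _ [_ af] aE]] := nbr_pair_at cA aA pA (etrans (edgeC _ _) pa).
  apply: (grow _ [set a] a f (leqnn _)) => //; rewrite ?sub1set ?inE //.
  - exact: edge_neq.
  - exact: CT_set1.
  - by apply: (@conn_star a) => [x|]; rewrite inE // => /eqP ->; rewrite eqxx.
  - by rewrite eq_sym edge_neq.
  - by rewrite eq_sym.
  move=> x z; rewrite !inE => /eqP -> zA az.
  by case: (aE z zA az) => ->; rewrite !eqxx ?orbT.
elim: n => // n IH X e f ltn XA pX cX kX aX eX fA fX fp ef XE.
have eA : e \in A by apply: (subsetP XA).
have [g [[_ gA] eg neg [_ fg] fE]] := nbr_pair_at cA fA eA (etrans (edgeC _ _) ef).
have gX : g \notin X.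
  apply/negP=> gX; have := XE g f gX fA; rewrite edgeC => /(_ fg).
  by rewrite (negPf fX) (negPf fp) eq_sym (negPf eg).
have fXA : f |: X \subset A by rewrite subUset sub1set fA.
have rimf : X :&: nbhd f = [set e].
  apply/setP=> y; rewrite !inE; apply/andP/eqP => [[yX fy]|->]; last first.
    by rewrite edgeC.
  have [//|yg] := fE y (subsetP XA _ yX) fy.
  by rewrite -yg yX in gX.
have cfX : CT (f |: X) by apply: CT_add; rewrite ?rimf //; apply: CT_set1.
have kfX : conn (f |: X).
  rewrite (_ : f |: X = [set e; f] :|: X); last first.
    apply/setP=> y; rewrite !inE.
    by have [->|_] := eqVneq y e; rewrite ?eX ?orbT.
  apply: (@connU _ _ e) => //; first by rewrite !inE eqxx.
  apply: (@conn_star e) => [x|]; rewrite !inE ?eqxx //.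
  by case/orP=> /eqP -> //; rewrite eqxx.
have fXE x z : x \in f |: X -> z \in A -> edge x z ->
    (z \in f |: X) || (z == p) || (x == f) && (z == g).
  rewrite !inE => /orP[/eqP->|xX] zA xz.
    by case: (fE z zA xz) => ->; rewrite ?eX !eqxx ?orbT.
  case/orP: (XE x z xX zA xz) => [/orP[->|->]|/andP[_ ->]];
  by rewrite ?orbT.
(* When the arc comes back to [p], the two neighbours of [p] are [a] and [f], both in [f |: X]; no
   edge leads to a further point, so the arc is all of [A :\ p]. *)
have [gp|gp] := eqVneq g p.
  suff -> : A :\ p = f |: X by [].
  apply/setP=> y; rewrite !inE; apply/andP/orP; last first.
    move=> [/eqP->|yX]; split=> //; last by apply: (subsetP XA).
    by apply: contraNneq pX => <-.
  move=> [yp yA].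
  suff : [|| y == p, y == f | y \in X].
    by case/or3P=> [yp'|->|->]; [rewrite yp' in yp|left|right].
  apply: (kA (fun y => [|| y == p, y == f | y \in X]) p) => //.
    by rewrite eqxx.
  move=> s t sA uA /or3P sX st.
  have [sfX|] := boolP (s \in f |: X).
    have := fXE s t sfX uA st; rewrite gp !inE.
    by move=> /orP[/orP[/orP[]|]|/andP[_]] ->; rewrite ?orbT.
  rewrite !inE negb_or => /andP[sf sX'].
  case: sX => [/eqP sp|sf'|sX]; [|by rewrite sf' in sf|by rewrite sX in sX'].
  have pf : edge p f by rewrite -gp edgeC.
  rewrite sp in st; have := pE t uA st; have := pE f fA pf.
  move=> [fa|->]; first by rewrite fa aX in fX.
  by case=> ->; rewrite ?aX ?eqxx ?orbT.
apply: (IH (f |: X) f g) => //; rewrite ?inE ?eqxx ?aX ?orbT //.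
- rewrite setUC -setDDl; rewrite (cardsD1 f) in ltn.
  by rewrite !inE fX fA in ltn.
- by rewrite negb_or eq_sym fp.
- by rewrite negb_or eq_sym edge_neq.
Qed.

End Circles.

(** * Transport along embeddings, and translation to the graph-level definitions *)

Lemma conn_emb (G H : graph) (f : G -> H) (A : {set G}) :
  emb f A -> conn A <-> conn (f @: A).
Proof.
move=> [f_inj fE]; split=> cA X x xA Xx XE y.
  move=> /imsetP[y' y'A ->]; case/imsetP: xA Xx => x' x'A -> Xx.
  apply: (cA (fun z => X (f z)) x') => // s t sA tA Xs st.
  by apply: XE Xs _; rewrite ?imset_f // fE.
pose Y z := [exists s in A, (f s == z) && X s].
have YE s : s \in A -> Y (f s) = X s.
  move=> sA; apply/exists_inP/idP => [[t tA /andP[/eqP/f_inj<- //]]|Xs].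
  by exists s; rewrite ?eqxx.
move=> yA; rewrite -YE //; apply: (cA Y (f x)); rewrite ?imset_f ?YE //.
move=> _ _ /imsetP[s sA ->] /imsetP[t tA ->]; rewrite !YE // fE //.
exact: XE.
Qed.

Lemma nbr_pair_emb (G H : graph) (f : G -> H) (A : {set G}) x a b :
  emb f A -> x \in A -> a \in A -> b \in A ->
  nbr_pair A x a b <-> nbr_pair (f @: A) (f x) (f a) (f b).
Proof.
move=> [f_inj fE] xA aA bA; split=> -[_ ab nab [xa xb] K].
  split; rewrite ?fE ?imset_f ?(inj_in_eq f_inj) //.
  move=> _ /imsetP[c cA ->]; rewrite fE // => /(K _ cA).
  by case=> ->; [left|right].
move: ab nab xa xb K; rewrite !fE // (inj_in_eq f_inj) // => ab nab xa xb K.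
split=> // c cA xc; have := K _ (imset_f f cA); rewrite fE // => /(_ xc).
by case=> /f_inj ->; rewrite ?inE //; [left|right].
Qed.

Lemma circle_emb (G H : graph) (f : G -> H) (A : {set G}) :
  emb f A -> circle A <-> circle (f @: A).
Proof.
move=> fA; split=> -[[x xA] cA tA]; split.
- by exists (f x); apply: imset_f.
- by apply/(conn_emb fA).
- move=> _ /imsetP[y yA ->]; have [a [b ab]] := tA y yA.
  have [[aA bA] _ _ _ _] := ab.
  by exists (f a), (f b); apply/(nbr_pair_emb fA).
- by case/imsetP: xA => x' x'A _; exists x'.
- exact/(conn_emb fA).
- move=> y yA; have [a [b ab]] := tA (f y) (imset_f f yA).
  case: (ab) => -[/imsetP[a' a'A ea] /imsetP[b' b'A eb]] _ _ _ _.
  by exists a', b'; apply/(nbr_pair_emb fA); rewrite // -ea -eb.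
Qed.

Lemma connectedP (G : graph) :
  connected G <-> (exists x : G, x \in [set: G]) /\ conn [set: G].
Proof.
split=> [[/card_gt0P[x _] cG]|[[x _] cG]]; split.
- by exists x.
- move=> X y _ Xy XE z _.
  have /closed_connect/(_ y z (cG y z)) : closed edge X.
    apply: intro_closed; last by move=> s t st Xs; apply: (XE s).
    exact/sym_connect_sym/edgeC.
  by rewrite !unfold_in Xy => <-.
- by apply/card_gt0P; exists x.
- move=> y z; apply: (cG (connect edge y) y) => // s t _ _ ys st.
  exact: connect_trans ys (connect1 st).
Qed.

Lemma card_induced (G : graph) (A : {set G}) : #|{: induced A}| = #|A|.
Proof. by rewrite card_sig; apply: eq_card. Qed.

Lemma sphere0_rimP (G : graph) (x : G) :
  sphere0 (rim x) <-> exists a b, nbr_pair [set: G] x a b.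
Proof.
rewrite /sphere0 card_induced; split=> [[/eqP/cards2P[a [b [ab nE]]] N]|].
  have aN : a \in nbhd x by rewrite nE !inE eqxx.
  have bN : b \in nbhd x by rewrite nE !inE eqxx orbT.
  exists a, b; split=> //; first exact: N (exist _ a aN) (exist _ b bN).
    by rewrite !inE in aN bN.
  move=> c _; rewrite -in_nbhd nE !inE => /orP[]/eqP->; [by left|by right].
move=> [a [b [_ ab nab [xa xb] H]]].
have nE : nbhd x = [set a; b].
  apply/setP=> c; rewrite !inE; apply/idP/orP => [/H[]// ->|[]/eqP -> //].
    by left.
  by right.
split; first by rewrite nE cards2 ab.
move=> [y yN] [z zN]; rewrite /= /induced_edge /=.
move: yN zN; rewrite nE !inE => /orP[]/eqP-> /orP[]/eqP->; rewrite ?edge_irr //.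
by rewrite edgeC.
Qed.

Lemma sphere1P (G : graph) : sphere1 G <-> circle [set: G].
Proof.
split=> [[/connectedP[nG cG] S]|[nG cG S]]; split=> //.
- by move=> x _; apply/sphere0_rimP/S.
- exact/connectedP.
- by move=> x; apply/sphere0_rimP/S.
Qed.

Lemma sphere1_induced (G : graph) (A : {set G}) :
  sphere1 (induced A) <-> circle A.
Proof.
split=> [/sphere1P|cA].
  by move=> /(circle_emb (emb_val _)); rewrite imset_val.
by apply/sphere1P/(circle_emb (emb_val _)); rewrite imset_val.
Qed.

Lemma connected_induced (G : graph) (A : {set G}) x :
  x \in A -> connected (induced A) <-> conn A.
Proof.
move=> xA; split=> [/connectedP[_]|cA].
  by move=> /(conn_emb (emb_val _)); rewrite imset_val.
apply/connectedP; split; first by exists (exist _ x xA).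
by apply/(conn_emb (emb_val _)); rewrite imset_val.
Qed.

(** * Digital 1-disks as induced paths *)

Lemma disk1_iso (G H : graph) : iso G H -> disk1 G -> disk1 H.
Proof.
by move=> GH [S [p [sS Sp]]]; exists S, p; split=> //; apply: iso_trans GH.
Qed.

Lemma circle_del_disk1 (G : graph) (A : {set G}) p :
  circle A -> p \in A -> disk1 (induced (A :\ p)).
Proof.
move=> cA pA; exists (induced A), (exist _ p pA); split.
  exact/sphere1_induced.
by rewrite -[p in A :\ p]/(val (exist _ p pA : induced A)) -ambient_del;
   apply: induced_ambient.
Qed.

(** The ends are the two neighbours of the deleted point [p] of the 1-sphere: each loses [p] and
    keeps a single neighbour. *)
Lemma disk1_ends (G : graph) (A : {set G}) : disk1 (induced A) ->
  exists e1 e2, [/\ e1 \in A, e2 \in A, e1 != e2, pendant A e1 & pendant A e2].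
Proof.
move=> [S [p [/sphere1P cS [f [[g fK gK] fE]]]]].
have [_ _ /(_ p (in_setT p))[a [b ab]]] := cS.
have [_ a_b _ [pa pb] _] := ab.
have ap : a \in [set~ p] by rewrite !inE eq_sym edge_neq.
have bp : b \in [set~ p] by rewrite !inE eq_sym edge_neq.
have pend e (ep : e \in [set~ p]) : edge p e -> pendant A (val (f (exist _ e ep))).
  rewrite edgeC => ep'; have [q [_ pq npq [_ eq] qE]] := nbr_pair_at cS (in_setT _) (in_setT _) ep'.
  have qp : q \in [set~ p] by rewrite !inE eq_sym.
  exists (val (f (exist _ q qp))); split; first exact: valP.
    by have := fE (exist _ e ep) (exist _ q qp); rewrite /= /induced_edge /= => ->.
  move=> c cA; pose c' : induced A := exist _ c cA.
  rewrite -[c]/(val c') -[c']gK => ec; congr (val (f _)); apply/val_inj => /=.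
  have := fE (exist _ e ep) (g c'); rewrite /= /induced_edge /= ec => /esym ec'.
  case: (qE _ (in_setT _) ec') => // gp.
  have : sval (g c') \in [set~ p] by exact: (svalP (g c')).
  by rewrite gp !inE eqxx.
exists (val (f (exist _ a ap))), (val (f (exist _ b bp))).
split; [exact: valP|exact: valP| |exact: pend|exact: pend].
by rewrite (inj_eq val_inj) (inj_eq (can_inj fK)).
Qed.

(** A new point joined to the two ends closes the path to a circle, from which the path is recovered
    by deleting that point. *)
Lemma pathI_disk1 (G : graph) (A : {set G}) (e1 e2 : G) :
    e1 \in A -> e2 \in A -> e1 != e2 -> ~~ edge e1 e2 ->
    pendant A e1 -> pendant A e2 -> conn A ->
    (forall x, x \in A -> x != e1 -> x != e2 -> exists a b, nbr_pair A x a b) ->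
  disk1 (induced A).
Proof.
move=> e1A e2A e12 n12 p1 p2 cA tA.
pose M := add_vertex [set e1; e2]; pose C : {set M} := None |: Some @: A.
have SomeC x : (Some x \in C) = (x \in A).
  by rewrite !inE /= mem_imset //; apply: Some_inj.
have NoneC : None \in C by rewrite !inE eqxx.
suff cC : circle C.
  have := circle_del_disk1 cC NoneC.
  have -> : C :\ None = Some @: A by rewrite setU1K //; apply/imsetP=> -[].
  exact/disk1_iso/iso_sym/emb_iso/emb_Some.
split; first by exists None.
  move=> X x xC Xx XE.
  have XA y : y \in A -> X (Some y) -> {in A, forall z, X (Some z)}.
    move=> yA Xy; apply: (cA (fun z => X (Some z)) y yA Xy) => s t sA tA' Xs st.
    by apply: (XE (Some s)); rewrite ?SomeC.
  have X1 : X (Some e1).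
    case: x xC Xx => [x|] xC Xx; first by apply: (XA x); rewrite // -SomeC.
    by apply: (XE None); rewrite ?SomeC //= !inE eqxx.
  move=> [y|] yC; first by apply: (XA e1); rewrite // -SomeC.
  by apply: (XE (Some e1)); rewrite ?SomeC //= !inE eqxx.
have tend e e' : (forall z, z \in [set e1; e2] -> (z == e) || (z == e')) ->
    e \in [set e1; e2] -> ~~ edge e e' -> e \in A -> pendant A e ->
    exists a b, nbr_pair C (Some e) a b.
  move=> E ee nee' eA [f [fA ef fE]]; exists (Some f), None.
  split; rewrite ?SomeC //=.
    apply/negP=> /E /orP[]/eqP ff; last by rewrite -ff ef in nee'.
    by rewrite ff edge_irr in ef.
  move=> [c|] //; last by right.
  by rewrite SomeC => cA' /= /(fE _ cA') ->; left.
move=> [x|] xC; last first.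
  exists (Some e1), (Some e2); split; rewrite ?SomeC //=; rewrite ?inE ?eqxx ?orbT //.
  move=> [c|//] _ /=; rewrite !inE => /orP[]/eqP->; [by left|by right].
rewrite SomeC in xC; have [->|x1] := eqVneq x e1.
  apply: (@tend e1 e2) => // [z|]; rewrite !inE ?eqxx //.
have [->|x2] := eqVneq x e2.
  apply: (@tend e2 e1); rewrite ?inE ?eqxx ?orbT 1?edgeC // => z.
  by rewrite !inE orbC.
have [a [b [[aA bA] ab nab [xa xb] xE]]] := tA x xC x1 x2.
exists (Some a), (Some b); split; rewrite ?SomeC //.
move=> [c|] //=; last by rewrite !inE (negPf x1) (negPf x2).
by rewrite SomeC => cA' /(xE _ cA')[]->; [left|right].
Qed.

Lemma path3_disk1 (G : graph) (e1 m e2 : G) :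
  e1 != e2 -> ~~ edge e1 e2 -> edge m e1 -> edge m e2 ->
  disk1 (induced [set m; e1; e2]).
Proof.
move=> e12 n12 m1 m2; apply: (@pathI_disk1 _ _ e1 e2) => //.
- by rewrite !inE eqxx orbT.
- by rewrite !inE eqxx orbT.
- exists m; rewrite !inE eqxx; split=> //; first by rewrite edgeC.
  move=> c; rewrite !inE -orbA => /or3P[]/eqP-> //; first by rewrite edge_irr.
  by rewrite (negPf n12).
- exists m; rewrite !inE eqxx; split=> //; first by rewrite edgeC.
  move=> c; rewrite !inE -orbA => /or3P[]/eqP-> //; last by rewrite edge_irr.
  by rewrite edgeC (negPf n12).
- apply: (@conn_star _ m) => [x|]; rewrite !inE ?eqxx // -orbA.
  by case/or3P=> /eqP-> //; rewrite eqxx.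
move=> x; rewrite !inE -orbA => /or3P[]/eqP-> x1 x2; last by rewrite eqxx in x2.
  exists e1, e2; split; rewrite ?inE ?eqxx ?orbT //.
  move=> c; rewrite !inE -orbA => /or3P[]/eqP->; last by right.
    by rewrite edge_irr.
  by left.
by rewrite eqxx in x1.
Qed.

(** This is the shape of the rim, in the union of the balls of two adjacent points [m1] and [m2], of
    a point adjacent to both. *)
Lemma path4_disk1 (G : graph) (e1 m1 m2 e2 : G) :
  edge e1 m1 -> edge m1 m2 -> edge m2 e2 ->
  ~~ edge e1 m2 -> ~~ edge m1 e2 -> ~~ edge e1 e2 -> e1 != m2 -> e2 != m1 ->
  disk1 (induced [set m1; m2; e1; e2]).
Proof.
move=> E1 E2 E3 N1 N2 N3 D1 D2.
have E1' : edge m1 e1 by rewrite edgeC.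
have E2' : edge m2 m1 by rewrite edgeC.
have E3' : edge e2 m2 by rewrite edgeC.
have N1' : ~~ edge m2 e1 by rewrite edgeC.
have N2' : ~~ edge e2 m1 by rewrite edgeC.
have N3' : ~~ edge e2 e1 by rewrite edgeC.
have mP x : x \in [set m1; m2; e1; e2] ->
    [\/ x = m1, x = m2, x = e1 | x = e2].
  rewrite !inE -!orbA => /or4P[]/eqP->;
    by [apply: Or41|apply: Or42|apply: Or43|apply: Or44].
have D3 : e1 != e2 by apply: contraNneq N1 => ->.
apply: (@pathI_disk1 _ _ e1 e2); rewrite // ?inE ?eqxx ?orbT //.
- exists m1; split; rewrite ?inE ?eqxx ?orbT // => c.
  by case/mP=> ->; rewrite ?edge_irr ?(negPf N1) ?(negPf N3).
- exists m2; split; rewrite ?inE ?eqxx ?orbT // => c.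
  by case/mP=> ->; rewrite ?edge_irr ?(negPf N2') ?(negPf N3').
- have -> : [set m1; m2; e1; e2] = [set m1; m2; e1] :|: [set m2; e2].
    apply/setP=> x; rewrite !inE.
    by case: (x == m2); rewrite ?orbT ?orbF.
  apply: (@connU _ _ _ m2); rewrite ?inE ?eqxx ?orbT //.
    apply: (@conn_star _ m1) => [x|]; rewrite !inE ?eqxx // -orbA.
    by case/or3P=> /eqP-> //; rewrite eqxx.
  apply: (@conn_star _ m2) => [x|]; rewrite !inE ?eqxx //.
  by case/orP=> /eqP-> //; rewrite eqxx.
move=> x /mP[]-> ; rewrite ?eqxx // => X1 X2.
  exists m2, e1; split; rewrite ?inE ?eqxx ?orbT // 1?eq_sym // => c.
  case/mP=> ->; rewrite ?edge_irr ?(negPf N2) // => _; by [left|right].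
exists m1, e2; split; rewrite ?inE ?eqxx ?orbT // 1?eq_sym // => c.
case/mP=> ->; rewrite ?edge_irr ?(negPf N1') // => _; by [left|right].
Qed.

(** * Disks, manifolds and spheres *)

(** [disk2] with the disk and its boundary both written as sets of points of one fixed graph; see
    [disk2_ambient]. *)
Definition disk (G : graph) (D B : {set G}) : Prop :=
  [/\ CT D /\ conn D,
      B \subset D,
      exists x, x \in D :\: B,
      (forall x, x \in B -> disk1 (induced (D :&: nbhd x))) /\
      (forall x, x \in D -> x \notin B -> circle (D :&: nbhd x))
    & circle B].

Lemma iso_rim_induced (G : graph) (D : {set G}) (x : induced D) :
  iso (rim x) (induced (D :&: nbhd (val x))).
Proof. by rewrite -ambient_nbhd; apply: induced_ambient. Qed.

Lemma disk2_ambient (G : graph) (D : {set G}) (B : {set induced D}) :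
  disk2 B <-> disk D (ambient B).
Proof.
have BD : ambient B \subset D.
  by apply/subsetP=> _ /imsetP[x _ ->]; apply: valP.
have inB (x : induced D) : (val x \in ambient B) = (x \in B).
  by rewrite mem_imset //; apply: val_inj.
have sE (x : induced D) : sphere1 (rim x) <-> circle (D :&: nbhd (val x)).
  rewrite -ambient_nbhd; apply: iff_trans (sphere1_induced _) _.
  exact: (circle_emb (emb_val _)).
split=> [[cD kD [_ /set0Pn[y yB]] [d1 s1] sB]|[[kD cD] _ [y]]].
  split=> //.
  - by split=> //; apply/(connected_induced (valP y)).
  - by exists (val y); rewrite inE inB -in_setC yB; apply: valP.
  - split=> [_ /imsetP[x xB ->]|x xD].
      exact: disk1_iso (iso_rim_induced x) (d1 x xB).
    rewrite -[x]/(val (exist _ x xD : induced D)) inB => xB.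
    by apply/sE/s1; rewrite inE.
  - exact/(circle_emb (emb_val _))/sphere1_induced.
rewrite !inE => /andP[yB yD] [d1 s1] cB; split=> //.
- exact/(connected_induced yD).
- split; last by apply/set0Pn; exists (exist _ y yD); rewrite inE -inB.
  by have [[_ /imsetP[x xB _]] _ _] := cB; apply/set0Pn; exists x.
- split=> [x xB|x]; first by
    apply: (disk1_iso (iso_sym (iso_rim_induced x))); apply: d1; rewrite inB.
  by rewrite inE -inB => xB; apply/sE/s1 => //; apply: valP.
- exact/sphere1_induced/(circle_emb (emb_val _)).
Qed.

Lemma ambient_preim (G : graph) (D B : {set G}) : B \subset D ->
  ambient [set x : induced D | val x \in B] = B.
Proof.
move=> /subsetP BD; apply/setP=> y; apply/imsetP/idP => [[x]|yB].
  by rewrite inE => ? ->.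
by exists (exist _ y (BD y yB)); rewrite ?inE.
Qed.

Lemma disk_disk2 (G : graph) (D B : {set G}) : disk D B ->
  disk2 [set x : induced D | val x \in B].
Proof.
by move=> dD; apply/disk2_ambient; rewrite ambient_preim //; case: dD.
Qed.

Lemma manifold2P (G : graph) : manifold2 G <->
  [/\ exists x : G, x \in [set: G], conn [set: G]
    & forall x : G, circle (nbhd x)].
Proof.
split=> [[/connectedP[nG cG] S]|[nG cG S]]; split=> //.
- by move=> x; apply/sphere1_induced/S.
- exact/connectedP.
- by move=> x; apply/sphere1_induced/S.
Qed.

Definition pt (G : graph) (A : {set G}) (x : G) (xA : x \in A) : induced A :=
  exist (fun z => z \in A) x xA.

(** * Balls, their complements and punctured 2-manifolds *)

Section Manifold.
Variable K : graph.
Hypothesis mK : manifold2 K.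
Implicit Types (x y u v w : K).

Let cN x : circle (nbhd x). Proof. by case/manifold2P: mK. Qed.
Let cK : conn [set: K]. Proof. by case/manifold2P: mK. Qed.

Lemma rim_nbr_pair x y : edge x y -> exists a b, nbr_pair (nbhd x) y a b.
Proof. by move=> xy; case: (cN x) => _ _; apply; rewrite in_nbhd. Qed.

Lemma exists_edge x : exists y, edge x y.
Proof. by have [[y]] := cN x; rewrite in_nbhd; exists y. Qed.

Lemma subcircle_nbhd x (A : {set K}) a : a \in A -> A \subset nbhd x ->
    (forall y, y \in A ->
       exists b c, [/\ b \in A, c \in A, b != c, edge y b & edge y c]) ->
  nbhd x = A.
Proof. by move=> aA Ax tA; symmetry; apply: circle_minimal (cN x) Ax aA tA. Qed.

(** In the rim of a neighbour [y] of [x], a point [a] next to [x] has a second neighbour [z], which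
    is neither [x] nor adjacent to [x]. *)
Lemma outside_ball x : exists y, y \notin x |: nbhd x.
Proof.
have [y xy] := exists_edge x; have yx : edge y x by rewrite edgeC.
have [a [_ [[aN _] _ _ [xa _] _]]] := rim_nbr_pair yx.
have [z [_ xz nxz _ _]] : exists z, nbr_pair (nbhd y) a x z.
  by apply: (nbr_pair_at (cN y) aN); rewrite ?in_nbhd // edgeC.
by exists z; rewrite !inE negb_or eq_sym xz nxz.
Qed.

(** From K - x, delete [y] and then put [x] back. The two rims met on the way are O(y) - x and O(x)
    - y, circles minus a point, which are contractible by [circle_arc]. *)
Lemma CT_del_adj x y : edge x y -> CT [set~ x] -> CT [set~ y].
Proof.
move=> xy cx; have xNy := edge_neq xy.
have -> : [set~ y] = x |: ([set~ x] :\ y).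
  apply/setP=> z; rewrite !inE; have [->|] := eqVneq z x => //=.
  by rewrite andbT.
have arc (z t : K) : edge t z -> CT (nbhd z :\ t).
  rewrite edgeC -in_nbhd => tz; by have [] := circle_arc (cN z) tz.
apply: CT_add; first by rewrite !inE eqxx andbF.
  apply: CT_del => //; first by rewrite !inE eq_sym.
  have -> : [set~ x] :&: nbhd y = nbhd y :\ x by apply/setP=> z; rewrite !inE.
  exact: arc.
have -> : ([set~ x] :\ y) :&: nbhd x = nbhd x :\ y.
  apply/setP=> z; rewrite !inE; have [->|] /= := eqVneq z x; last by rewrite andbT.
  by rewrite edge_irr !andbF.
by apply: (arc x y); rewrite edgeC.
Qed.

Lemma CT_del_all x y : CT [set~ x] -> CT [set~ y].
Proof.
move=> cx; pose X z := connect edge x z.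
suff : X y.
  case/connectP=> p; elim: p x cx {X} => [|z p IH] x cx /=; first by move=> _ ->.
  by move=> /andP[xz zp]; apply: IH zp; apply: CT_del_adj cx.
apply: (cK (X := X) (x := x)) => //; first exact: connect0.
by move=> s t _ _ xs /connect1; apply: connect_trans.
Qed.

(** The ball is a cone with apex [x]; the rim in it of a boundary point [y] is the path formed by
    [x] and the two neighbours of [y] on O(x). *)
Lemma ball_disk x : disk (x |: nbhd x) (nbhd x).
Proof.
have xball : x \in x |: nbhd x by rewrite !inE eqxx.
have star y : y \in x |: nbhd x -> y != x -> edge x y.
  by rewrite !inE => /orP[->|].
split=> //.
- by split; [apply: CT_cone xball star|apply: conn_star star xball].
- exact: subsetUr.
- by exists x; rewrite !inE eqxx edge_irr.
split=> [y|y]; last first.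
  rewrite !inE => /orP[/eqP-> _|-> //].
  suff -> : (x |: nbhd x) :&: nbhd x = nbhd x by [].
  by apply/setIidPr/subsetUr.
rewrite in_nbhd => xy; have [a [b]] := rim_nbr_pair xy.
rewrite /nbr_pair !in_nbhd => -[[xa xb] ab nab [ya yb] E].
have -> : (x |: nbhd x) :&: nbhd y = [set x; a; b].
  apply/setP=> z; rewrite !inE; have [->|zx] /= := eqVneq z x.
    by rewrite edgeC.
  apply/andP/orP => [[xz yz]|[]/eqP-> //].
  by case: (E z); rewrite ?in_nbhd // => ->; rewrite eqxx; [left|right].
exact: path3_disk1.
Qed.

(** Neighbours of [x] lose [x] from their rims, which become arcs; all other points keep their full
    rims. *)
Lemma complement_ball_disk x : CT [set~ x] -> disk [set~ x] (nbhd x).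
Proof.
move=> cx; have nNx y : edge x y -> y != x by rewrite eq_sym; apply: edge_neq.
split.
- split=> // X y; rewrite !inE => yx Xy XE.
  have XN z : X z -> edge x z -> {in nbhd x, forall t, X t}.
    move=> Xz xz; have [_ kN _] := cN x.
    apply: (kN X z) => //; rewrite ?in_nbhd // => s t; rewrite !in_nbhd => xs xt.
    by apply: XE; rewrite !inE nNx.
  (* Connections through [x] are rerouted along the circle O(x): [X'] extends [X] to [x] by asking
     whether [X] holds at some neighbour of [x], and by [XN] it then holds at all of them. *)
  pose X' z := if z == x then [exists t, edge x t && X t] else X z.
  move=> z; rewrite !inE => zx.
  suff : X' z by rewrite /X' (negPf zx).
  apply: (cK (X := X') (x := y)); rewrite ?inE //; first by rewrite /X' (negPf yx).
  move=> s t _ _ + st; rewrite /X'.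
  have [sx /existsP[r /andP[xr Xr]]|sx Xs] := eqVneq s x.
    have [|_] := eqVneq t x; first by move=> tx; rewrite sx tx edge_irr in st.
    by apply: (XN r); rewrite ?in_nbhd // -sx.
  have [tx|tx] := eqVneq t x; last by apply: (XE s); rewrite ?inE.
  by apply/existsP; exists s; rewrite Xs edgeC -tx st.
- by apply/subsetP=> y; rewrite !inE; apply: nNx.
- have [y] := outside_ball x; rewrite !inE negb_or => /andP[yx nxy].
  by exists y; rewrite !inE nxy yx.
- split=> [y|y]; rewrite !inE => xy.
    have -> : [set~ x] :&: nbhd y = nbhd y :\ x by apply/setP=> z; rewrite !inE.
    by apply: circle_del_disk1; rewrite ?in_nbhd // edgeC.
  move=> nxy; have -> // : [set~ x] :&: nbhd y = nbhd y.
  apply/setIidPr/subsetP=> z; rewrite !inE => yz.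
  by apply: contraNneq nxy => <-; rewrite edgeC.
- exact: cN.
Qed.

(** Take for [g] the identity of [S]. Since no edge joins the two interiors, the edges of [glue g]
    are exactly those of [K]. *)
Lemma union_sphere2 (D C S : {set K}) : disk D S -> disk C S ->
    D :&: C = S -> D :|: C = setT ->
    (forall x y, x \in D -> x \notin S -> y \in C -> y \notin S ->
       ~~ edge x y) ->
  sphere2 K.
Proof.
move=> dD dC ES ET sep.
have SD x : x \in S -> x \in D by rewrite -ES => /setIP[].
have SC x : x \in S -> x \in C by rewrite -ES => /setIP[].
pose BD := [set x : induced D | val x \in S].
pose BC := [set x : induced C | val x \in S].
have gP (x : induced BC) : val (val x) \in S by have := valP x; rewrite inE.
have g1P (x : induced BC) : pt (SD _ (gP x)) \in BD.
  by rewrite inE; exact: gP.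
pose g (x : induced BC) : induced BD := pt (g1P x).
exists (induced D), (induced C), BD, BC, g; split.
- exact: (disk_disk2 dD).
- exact: (disk_disk2 dC).
- split; last by [].
  apply: inj_surj_bij => [x y /(congr1 (val \o val)) /= e|[[x xD] xS]].
    by do 2!apply/val_inj.
  have xS' : x \in S by move: (xS); rewrite inE.
  have xBC : pt (SC _ xS') \in BC by rewrite inE.
  by exists (pt xBC); do 2!apply/val_inj.
have outS (y : {y : induced C | y \notin BC}) : val (val y) \notin S.
  by have := valP y; rewrite inE.
have outD (y : {y : induced C | y \notin BC}) : val (val y) \notin D.
  apply: contra (outS y) => yD; rewrite -ES inE yD /=; exact: valP (val y).
pose f (p : glue g) : K := match p with inl x => val x | inr y => val (val y) end.
have glueE (x : induced D) (y : {y : induced C | y \notin BC}) :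
    [exists b : induced BC, (val (g b) == x) && edge (val b) (val y)]
    = edge (val x) (val (val y)).
  apply/existsP/idP => [[b /andP[/eqP<- //]]|xy].
  have xS : val x \in S.
    apply: contraLR xy => xS; apply: sep xS _ (outS y); first exact: valP x.
    exact: valP (val y).
  have xBC : pt (SC _ xS) \in BC by rewrite inE.
  exists (pt xBC); apply/andP; split=> //.
  by apply/eqP/val_inj.
exists f; split.
  apply: inj_surj_bij => [[x|x] [y|y] /= e|x].
  - by congr inl; apply: val_inj.
  - by case/negP: (outD y); rewrite /= -e; exact: (valP x).
  - by case/negP: (outD x); rewrite /= e; exact: (valP y).
  - by congr inr; do 2!apply: val_inj.
  have [xD|xD] := boolP (x \in D); first by exists (inl (pt xD)).
  have xC : x \in C by have := in_setT x; rewrite -ET inE (negPf xD).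
  have xBC : pt xC \notin BC.
    by rewrite inE /=; apply: contra xD => /SD.
  by exists (inr (exist (fun z => z \notin BC) (pt xC) xBC)).
move=> [x|x] [y|y] //=; first by rewrite glueE.
by rewrite glueE edgeC.
Qed.

Lemma CT_del_sphere2 x : CT [set~ x] -> sphere2 K.
Proof.
move=> cx; apply: (union_sphere2 (ball_disk x) (complement_ball_disk cx)).
- apply/setP=> y; rewrite !inE; have [->|] /= := eqVneq y x; last by rewrite andbT.
  by rewrite edge_irr.
- by apply/setP=> y; rewrite !inE; case: eqVneq => //; rewrite orbT.
move=> y z; rewrite !inE => /orP[/eqP-> _ _ //|-> //].
Qed.

(** K - x is a cone with apex [y], because no edge leaves the set formed by [x], [y] and their
    common rim: a point [s] of that rim sees the cycle [x], [a], [y], [b], with [a] and [b] its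
    neighbours on O(x), and this cycle is the whole of O(s). *)
Lemma twin_CT x y : x != y -> nbhd x = nbhd y -> CT [set~ x].
Proof.
move=> xy Nxy; have yE z : edge y z = edge x z by rewrite -!in_nbhd Nxy.
apply: (@CT_cone _ y) => [|z]; first by rewrite !inE eq_sym.
rewrite !inE yE => zx zy.
suff : [|| z == x, z == y | edge x z] by rewrite (negPf zx) (negPf zy).
apply: (cK (X := fun z => [|| z == x, z == y | edge x z]) (x := x)) => //.
  by rewrite eqxx.
move=> s t _ _ /or3P[/eqP->|/eqP->|xs] st; first by rewrite st !orbT.
  by rewrite -yE st !orbT.
have [a [b]] := rim_nbr_pair xs.
rewrite /nbr_pair !in_nbhd => -[[xa xb] ab nab [sa sb] _].
have Ns : nbhd s = [set x; y; a; b].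
  apply: (@subcircle_nbhd s _ x); first by rewrite !inE eqxx.
    apply/subsetP=> r; rewrite !inE -!orbA => /or4P[]/eqP-> //.
      by rewrite edgeC.
    by rewrite edgeC yE.
  move=> r; rewrite !inE -!orbA => /or4P[]/eqP->;
    [exists a, b|exists a, b|exists x, y|exists x, y];
    by rewrite !inE !eqxx ?orbT // ?yE ?[edge _ x]edgeC ?[edge _ y]edgeC ?yE.
move: st; rewrite -in_nbhd Ns !inE -!orbA.
by case/or4P=> /eqP->; rewrite ?eqxx ?xa ?xb ?orbT.
Qed.

End Manifold.

(** * The union of two adjacent balls *)

Section EdgeBall.
Variable K : graph.
Hypothesis mK : manifold2 K.
Implicit Types (x y u v w : K).

Let cN x : circle (nbhd x). Proof. by case/manifold2P: mK. Qed.

(** The edge [u v] is a side of no induced square [u], [p], [q], [v]. *)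
Definition square_free u v : Prop :=
  forall p q, edge u p -> p != v -> ~~ edge v p ->
    edge v q -> q != u -> ~~ edge u q -> ~~ edge p q.

Lemma square_freeC u v : square_free u v -> square_free v u.
Proof. by move=> sf p q ? ? ? ? ? ?; rewrite edgeC; apply: sf. Qed.

Lemma common_nbr x u v : edge u v -> edge u x -> edge v x ->
  exists c, [/\ edge v c, c != u, edge x c, ~~ edge u c &
    forall z, edge v z -> edge x z -> z = u \/ z = c].
Proof.
move=> uv ux vx.
have [c] : exists c, nbr_pair (nbhd v) x u c.
  by apply: (nbr_pair_at (cN v)); rewrite ?in_nbhd // edgeC.
rewrite /nbr_pair !in_nbhd => -[[_ vc] uc nuc [_ xc] E].
exists c; split=> //; first by rewrite eq_sym.
by move=> z vz; apply: E; rewrite in_nbhd.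
Qed.

(** A neighbour [z] of [x] adjacent to [u] but not to [v] would complete an induced square [u], [z],
    [x], [v]; so, besides [v], only the two neighbours of [x] on O(v) remain. *)
Lemma rim_one_side u v x : edge u v -> square_free u v ->
    edge v x -> ~~ edge u x -> x != u ->
  exists a b, [/\ (nbhd u :|: nbhd v) :&: nbhd x = [set v; a; b],
    edge v a /\ edge v b, a != b, ~~ edge a b & edge x a /\ edge x b].
Proof.
move=> uv sf vx nux xu; have [a [b]] := rim_nbr_pair mK vx.
rewrite /nbr_pair !in_nbhd => -[[va vb] ab nab [xa xb] E].
exists a, b; split=> //; apply/setP=> z; rewrite !inE.
have [->|zv] /= := eqVneq z v; first by rewrite uv /= edgeC.
apply/andP/orP => [[uvz xz]|[]/eqP->]; try by rewrite ?va ?vb ?orbT.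
have vz : edge v z.
  apply: contraLR xz => nvz; rewrite edgeC; apply: sf => //.
  by rewrite (negPf nvz) orbF in uvz.
by case: (E z); rewrite ?in_nbhd // => ->; rewrite eqxx; [left|right].
Qed.

(** The circle O(v) supplies the neighbour [c] of [x] besides [u], and O(u) the neighbour [d]
    besides [v]. As [d] and [c] are not adjacent, the rim is the path [d], [u], [v], [c]. *)
Lemma rim_common u v x : edge u v -> square_free u v ->
    edge v x -> edge u x ->
  exists c d, [/\ (nbhd u :|: nbhd v) :&: nbhd x = [set u; v; d; c],
    [/\ edge v c, c != u, ~~ edge u c & edge x c],
    [/\ edge u d, d != v, ~~ edge v d & edge x d] & ~~ edge d c].
Proof.
move=> uv sf vx ux; have vu : edge v u by rewrite edgeC.
have [c [vc cu xc nuc cE]] := common_nbr uv ux vx.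
have [d [ud dv xd nvd dE]] := common_nbr vu vx ux.
exists c, d; split=> //; last exact: sf.
apply/setP=> z; rewrite !inE; apply/andP/idP => [[/orP[uz|vz] xz]|].
- by case: (dE z uz xz) => ->; rewrite eqxx ?orbT.
- by case: (cE z vz xz) => ->; rewrite eqxx ?orbT.
by rewrite -!orbA => /or4P[]/eqP->; split; rewrite ?ud ?vc ?uv ?vu ?orbT //;
   rewrite edgeC.
Qed.

(** [CT_glue] applies to the two balls, as square-freeness forbids edges between their differences.
    The cone point is then attached to the ball of [v] along the intersection of the balls, itself a
    cone with apex [v]. *)
Lemma edge_ball_CT u v : edge u v -> square_free u v -> CT (nbhd u :|: nbhd v).
Proof.
move=> uv sf; have vu : edge v u by rewrite edgeC.
pose X := u |: nbhd u; pose Y := v |: nbhd v.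
have -> : nbhd u :|: nbhd v = X :|: Y.
  apply/setP=> z; rewrite !inE.
  have [->|_] := eqVneq z u; first by rewrite vu !orbT.
  by have [->|_] := eqVneq z v; rewrite ?uv.
apply: CT_glue.
- move=> x y; rewrite !inE !negb_or => /orP[/eqP->|ux] /andP[xv nvx].
    by rewrite vu in nvx.
  move=> /orP[/eqP->|vy] /andP[yu nuy]; first by rewrite uv in nuy.
  exact: sf.
- apply: (@CT_cone _ u) => [|x]; rewrite !inE ?eqxx // => /orP[->|] //.
apply: CT_add; first by apply/imsetP=> -[].
  apply/(CT_emb (emb_Some X Y)); apply: (@CT_cone _ v) => [|x].
    by rewrite !inE eqxx.
  by rewrite !inE => /orP[->|].
have -> : (Some @: Y : {set add_vertex X}) :&: nbhd (None : add_vertex X)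
          = Some @: (Y :&: X).
  apply/setP=> -[z|]; rewrite !inE /=; last first.
    by rewrite andbF; symmetry; apply/imsetP=> -[].
  by rewrite !mem_imset ?inE //; apply: Some_inj.
apply/(CT_emb (emb_Some X _)); apply: (@CT_cone _ v) => [|x].
  by rewrite !inE eqxx uv orbT.
by rewrite !inE => /andP[/orP[->|]].
Qed.

(** The interior consists of [u] and [v]. The boundary is the union of the arcs O(u) - v and O(v) -
    u, connected because both contain the common neighbour [a]. *)
Lemma edge_ball_disk u v : edge u v -> square_free u v ->
  disk (nbhd u :|: nbhd v) ((nbhd u :|: nbhd v) :\ u :\ v).
Proof.
move=> uv sf; have vu : edge v u by rewrite edgeC.
have sf' := square_freeC sf.
have [a [b]] := rim_nbr_pair mK vu; rewrite /nbr_pair !in_nbhd => -[[va vb] ab nab [ua ub] _].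
have neq x y : edge x y -> y != x by rewrite eq_sym; apply: edge_neq.
split.
- split; first exact: edge_ball_CT.
  have -> : nbhd u :|: nbhd v = (u |: nbhd u) :|: (v |: nbhd v).
    apply/setP=> z; rewrite !inE.
    have [->|_] := eqVneq z u; first by rewrite vu !orbT.
    by have [->|_] := eqVneq z v; rewrite ?uv.
  apply: (@connU _ _ _ v); rewrite ?inE ?eqxx ?uv ?orbT //.
    apply: (@conn_star _ u) => [x|]; rewrite !inE ?eqxx // => /orP[->|] //.
  by apply: (@conn_star _ v) => [x|]; rewrite !inE ?eqxx // => /orP[->|].
- by rewrite setDDl subsetDl.
- by exists u; rewrite !inE eqxx vu andbF /= orbT.
- split=> [x|x].
    rewrite !inE => /andP[xv /andP[xu]].
    have [vx _|nvx] := boolP (edge v x).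
      have [ux|nux] := boolP (edge u x).
        have [c [d [-> [vc cu nuc xc] [ud dv nvd xd] ndc]]] :=
          rim_common uv sf vx ux.
        by apply: path4_disk1; rewrite // edgeC.
      have [c [d [-> [vc vd] cd ncd _]]] := rim_one_side uv sf vx nux xu.
      exact: path3_disk1.
    rewrite orbF setUC => ux.
    have [c [d [-> [uc ud] cd ncd _]]] := rim_one_side vu sf' ux nvx xv.
    exact: path3_disk1.
  rewrite !inE => xD; rewrite xD andbT negb_and !negbK.
  case/orP=> /eqP->; rewrite setIC; [rewrite setKU|rewrite setUC setKU]; exact: cN.
- have BE : (nbhd u :|: nbhd v) :\ u :\ v = (nbhd u :\ v) :|: (nbhd v :\ u).
    apply/setP=> z; rewrite !inE.
    have [->|_] := eqVneq z u; first by rewrite edge_irr ?andbF.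
    have [->|_] := eqVneq z v; first by rewrite edge_irr.
    by rewrite /= orbC.
  split.
  + by exists a; rewrite !inE ua (neq _ _ ua) (neq _ _ va).
  + rewrite BE; apply: (@connU _ _ _ a).
    * by rewrite !inE ua (neq _ _ va).
    * by rewrite !inE va (neq _ _ ua).
    * by have [] := circle_arc (cN u) (_ : v \in nbhd u); rewrite ?in_nbhd.
    * by have [] := circle_arc (cN v) (_ : u \in nbhd v); rewrite ?in_nbhd.
  move=> x; rewrite !inE => /andP[xv /andP[xu xD]].
  (* In every case [c] and [d] are the ends of the path that is the rim of [x] in the disk: they are
     what is left once [u] and [v] are dropped. *)
  suff [c [d [cd ncd [xc cB] [xd dB] E]]] : exists c d,
      [/\ c != d, ~~ edge c d, edge x c /\ [&& c != u, c != v & edge u c || edge v c],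
          edge x d /\ [&& d != u, d != v & edge u d || edge v d]
        & forall z, z != u -> z != v -> z \in (nbhd u :|: nbhd v) :&: nbhd x ->
            z = c \/ z = d].
    exists c, d; split=> //.
      by rewrite !inE; move: cB dB => /and3P[-> -> ->] /and3P[-> -> ->].
    move=> z; rewrite !inE => /andP[zv /andP[zu zD]] xz; apply: E => //.
    by rewrite !inE zD.
  have [vx|nvx] := boolP (edge v x).
    have [ux|nux] := boolP (edge u x).
      have [c [d [-> [vc cu nuc xc] [ud dv nvd xd] ndc]]] :=
        rim_common uv sf vx ux.
      exists c, d; split.
      - by apply: contraNneq nuc => ->.
      - by rewrite edgeC.
      - by split=> //; rewrite cu (neq _ _ vc) vc orbT.
      - by split=> //; rewrite dv (neq _ _ ud) ud.
      move=> z zu zv; rewrite !inE (negPf zu) (negPf zv) /=.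
      by case/orP=> /eqP->; [right|left].
    have [c [d [-> [vc vd] cd ncd [xc xd]]]] := rim_one_side uv sf vx nux xu.
    exists c, d; split; rewrite // ?(neq _ _ vc) ?(neq _ _ vd) ?vc ?vd ?orbT ?andbT.
    - by split=> //; apply: contraNneq nux => <-; rewrite edgeC.
    - by split=> //; apply: contraNneq nux => <-; rewrite edgeC.
    move=> z zu zv; rewrite !inE (negPf zv) /=.
    by case/orP=> /eqP->; [left|right].
  have ux : edge u x by rewrite (negPf nvx) orbF in xD.
  have := rim_one_side vu sf' ux nvx xv; rewrite setUC.
  move=> [c [d [-> [uc ud] cd ncd [xc xd]]]].
  exists c, d; split; rewrite // ?(neq _ _ uc) ?(neq _ _ ud) ?uc ?ud ?andbT /=.
  - by split=> //; apply: contraNneq nvx => <-; rewrite edgeC.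
  - by split=> //; apply: contraNneq nvx => <-; rewrite edgeC.
  move=> z zu zv; rewrite !inE (negPf zu) /=.
  by case/orP=> /eqP->; [left|right].
Qed.

End EdgeBall.

(** * Manifolds in which every circle is a rim *)

Section RimCircles.
Variable K : graph.
Hypothesis mK : manifold2 K.
Implicit Types (t u v w x y z p q : K).

Lemma square_circle (a b c d : K) :
  [/\ edge a b, edge b c, edge c d & edge d a] ->
  a != c -> b != d -> ~~ edge a c -> ~~ edge b d -> circle [set a; b; c; d].
Proof.
move=> [ab bc cd da] ac bd nac nbd.
have nca : ~~ edge c a by rewrite edgeC.
have ndb : ~~ edge d b by rewrite edgeC.
have ba : edge b a by rewrite edgeC.
have cb : edge c b by rewrite edgeC.
have dc : edge d c by rewrite edgeC.
have ad : edge a d by rewrite edgeC.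
have mP x : x \in [set a; b; c; d] -> [\/ x = a, x = b, x = c | x = d].
  rewrite !inE -!orbA => /or4P[]/eqP->;
    by [apply: Or41|apply: Or42|apply: Or43|apply: Or44].
split.
- by exists a; rewrite !inE eqxx.
- have -> : [set a; b; c; d] = [set a; b; c] :|: [set a; d].
    by apply/setP=> x; rewrite !inE; case: (x == a); rewrite ?orbT ?orbF.
  apply: (@connU _ _ _ a); rewrite ?inE ?eqxx ?orbT //.
    apply: (@conn_star _ b) => [x|]; rewrite !inE ?eqxx ?orbT // -orbA.
    by case/or3P=> /eqP-> //; rewrite eqxx.
  apply: (@conn_star _ a) => [x|]; rewrite !inE ?eqxx //.
  by case/orP=> /eqP-> //; rewrite eqxx.
move=> x /mP[]->.
- exists b, d; split; rewrite ?inE ?eqxx ?orbT // => y.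
  by case/mP=> ->; rewrite ?edge_irr ?(negPf nac) // => _; [left|right].
- exists a, c; split; rewrite ?inE ?eqxx ?orbT // => y.
  by case/mP=> ->; rewrite ?edge_irr ?(negPf nbd) // => _; [left|right].
- exists b, d; split; rewrite ?inE ?eqxx ?orbT // => y.
  by case/mP=> ->; rewrite ?edge_irr ?(negPf nca) // => _; [left|right].
- exists a, c; split; rewrite ?inE ?eqxx ?orbT // 1?eq_sym // => y.
  by case/mP=> ->; rewrite ?edge_irr ?(negPf ndb) // => _; [left|right].
Qed.

(** By minimality of circles, a 4-cycle found inside a rim is the whole rim; [nbhd_pentagon] does
    the same for 5-cycles. *)
Lemma nbhd_square v a b c d :
    [/\ edge v a, edge v b, edge v c & edge v d] ->
    [/\ edge a b, edge b c, edge c d & edge d a] -> a != c -> b != d ->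
  nbhd v = [set a; b; c; d].
Proof.
move=> [va vb vc vd] [ab bc cd da] ac bd.
apply: (subcircle_nbhd mK (a := a)); first by rewrite !inE eqxx.
  by apply/subsetP=> z; rewrite !inE -!orbA => /or4P[]/eqP->.
move=> z; rewrite !inE -!orbA => /or4P[]/eqP->;
  [exists b, d|exists a, c|exists b, d|exists a, c];
  by rewrite !inE !eqxx ?orbT; split=> //; rewrite edgeC.
Qed.

Lemma nbhd_pentagon v a b c d e :
    [/\ edge v a, edge v b, edge v c, edge v d & edge v e] ->
    [/\ edge a b, edge b c, edge c d, edge d e & edge e a] ->
    [/\ a != c, b != d, c != e, d != a & e != b] ->
  nbhd v = [set a; b; c; d; e].
Proof.
move=> [va vb vc vd ve] [ab bc cd de ea] [ac bd ce da eb].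
apply: (subcircle_nbhd mK (a := a)); first by rewrite !inE eqxx.
  by apply/subsetP=> z; rewrite !inE -!orbA => /or4P[| | |/orP[]]/eqP->.
move=> z; rewrite !inE -!orbA => /or4P[| | |/orP[]]/eqP->;
  [exists e, b|exists a, c|exists b, d|exists c, e|exists d, a];
  by rewrite !inE !eqxx ?orbT; split=> //; rewrite edgeC.
Qed.

Hypothesis circle_rim :
  forall S : {set K}, circle S -> exists w, nbhd w = S.

(** Both [v] and [y] are adjacent to every point of the path [x], [w], [u], [z]. If [x] and [z] are
    adjacent, this path closes to a 4-cycle that is the rim of both. Otherwise [v], [x], [y], [z] is
    an induced square, hence the rim of some [t], and [t] closes the path to a 5-cycle that is the
    rim of both. *)
Lemma degree4_twins w v u y x z :
    nbhd w = [set v; u; y; x] -> nbhd u = [set w; v; z; y] ->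
    [/\ edge v u, edge u y, edge y x & edge x v] ->
    v != y -> u != x -> ~~ edge v y -> ~~ edge u x ->
    edge v z -> edge y z -> z != w -> ~~ edge w z ->
  nbhd v = nbhd y.
Proof.
move=> Nw Nu [vu uy yx xv] vy ux nvy nux vz yz zw nwz.
have nbw t : (t \in [set v; u; y; x]) -> edge w t by rewrite -Nw in_nbhd.
have wv : edge w v by apply: nbw; rewrite !inE eqxx.
have wu : edge w u by apply: nbw; rewrite !inE eqxx !orbT.
have wy : edge w y by apply: nbw; rewrite !inE eqxx !orbT.
have wx : edge w x by apply: nbw; rewrite !inE eqxx !orbT.
have uz : edge u z by rewrite -in_nbhd Nu !inE eqxx !orbT.
have [xz|nxz] := boolP (edge x z).
  have N s : [/\ edge s x, edge s w, edge s u & edge s z] ->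
      nbhd s = [set x; w; u; z].
    move=> sE; apply: nbhd_square => //; rewrite 1?eq_sym //.
    by split; rewrite // edgeC.
  by rewrite !N //; split; rewrite // edgeC.
have zx : z != x by apply: contraNneq nwz => ->.
have [t Nt] : exists t, nbhd t = [set v; x; y; z].
  apply: circle_rim; apply: square_circle => //; last by rewrite eq_sym.
  by split; rewrite // edgeC.
have nbt s : (s \in [set v; x; y; z]) -> edge t s by rewrite -Nt in_nbhd.
have tv : edge t v by apply: nbt; rewrite !inE eqxx.
have tx : edge t x by apply: nbt; rewrite !inE eqxx !orbT.
have ty : edge t y by apply: nbt; rewrite !inE eqxx !orbT.
have tz : edge t z by apply: nbt; rewrite !inE eqxx !orbT.
have wt : w != t by apply: contraNneq nwz => ->.
have ut : u != t by apply: contraNneq nux => ->.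
have N s : [/\ edge s x, edge s w, edge s u, edge s z & edge s t] ->
    nbhd s = [set x; w; u; z; t].
  by move=> sE; apply: nbhd_pentagon => //; split; rewrite // 1?eq_sym // edgeC.
by rewrite !N //; split; rewrite // edgeC.
Qed.

Hypothesis edge_square : forall u v, edge u v -> exists p q,
  [/\ [/\ edge u p, p != v & ~~ edge v p],
      [/\ edge v q, q != u & ~~ edge u q] & edge p q].

(** An induced square through an edge [u v] is the rim of some [w]; an induced square through the
    edge [w v] is the rim of some [t]. Then [w] and [t] are adjacent points with 4-point rims, as
    [degree4_twins] requires. *)
Lemma exists_twins : exists v y, v != y /\ nbhd v = nbhd y.
Proof.
have /manifold2P[[u _] _ _] := mK.
have [v uv] := exists_edge mK u.
have [y [x [[uy yv nvy] [vx xu nux] yx]]] := edge_square uv.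
have vy : v != y by rewrite eq_sym.
have ux : u != x by rewrite eq_sym.
have sq : [/\ edge v u, edge u y, edge y x & edge x v].
  by split; rewrite // edgeC.
have [w Nw] := circle_rim (square_circle sq vy ux nvy nux).
have wv : edge w v by rewrite -in_nbhd Nw !inE eqxx.
have [p [z [[wp pv nvp] [vz zw nwz] pz]]] := edge_square wv.
(* On the rim [v], [u], [y], [x] of [w], only [y] is distinct from [v] and not adjacent to it. *)
have py : p = y.
  move: wp; rewrite -in_nbhd Nw !inE (negPf pv) /= -orbA.
  by case/or3P=> /eqP pE //; move: nvp; rewrite pE ?vx // edgeC uv.
subst p; exists v, y; split=> //.
have [t Nt] : exists t, nbhd t = [set w; v; z; y].
  apply: circle_rim; apply: square_circle => //; last by rewrite eq_sym.
  by split; rewrite // edgeC.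
have nbt s : (s \in [set w; v; z; y]) -> edge t s by rewrite -Nt in_nbhd.
have tw : edge t w by apply: nbt; rewrite !inE eqxx.
have tv : edge t v by apply: nbt; rewrite !inE eqxx !orbT.
have ty : edge t y by apply: nbt; rewrite !inE eqxx !orbT.
(* [t] lies on the rim of [w] and is adjacent to [v] and [y], so it is [u] or [x]; these two cases
   are mirror images. *)
move: (tw); rewrite edgeC -in_nbhd Nw !inE -!orbA.
case/or4P=> /eqP tE; subst t.
- by rewrite edge_irr in tv.
- by apply: (@degree4_twins w v u y x z) => //; rewrite edgeC.
- by rewrite edge_irr in ty.
- apply: (@degree4_twins w v x y u z); rewrite // 1?edgeC //.
  + by rewrite Nw; apply/setP=> s; rewrite !inE -!orbA; do !bool_congr.
  + by split; rewrite // edgeC.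
Qed.

End RimCircles.

(** * Shrinking a disk *)

Section Shrink.
Variables (K : graph) (D B : {set K}) (v : K).
Hypotheses (mK : manifold2 K) (dD : disk D B) (vD : v \in D) (vB : v \notin B).
Implicit Types (x y z w : K).

(** [J] has the same points as [K], so points and sets pass freely between the two. [I] is the
    interior of the disk and [R] the set of points that survive the shrinking. *)
Let J := join v B.
Let I := D :\: B.
Let R : {set J} := ~: (I :\ v).

Let cN x : circle (nbhd x). Proof. by case/manifold2P: mK. Qed.
Let BD x : x \in B -> x \in D.
Proof. by case: dD => _ /subsetP BD _ _ _; apply: BD. Qed.
Let inI x : (x \in I) = (x \notin B) && (x \in D). Proof. exact: in_setD. Qed.
Let inR x : (x \in R) = (x == v) || (x \notin I).
Proof. by rewrite !inE negb_and negbK. Qed.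

(** The rim of an interior point within [D] is a circle inside the circle O(x), hence all of it. *)
Lemma nbhd_interior x y : x \in I -> edge x y -> y \in D.
Proof.
rewrite inI => /andP[xB xD]; have [_ _ _ [_ /(_ x xD xB) cx] _] := dD.
have [[z zDx] _ tx] := cx.
have e : D :&: nbhd x = nbhd x.
  apply: circle_minimal (cN x) (subsetIr _ _) zDx _ => t /tx[a [b]].
  by case=> -[? ?] ? _ [? ?] _; exists a, b.
by rewrite -in_nbhd -e => /setIP[].
Qed.

Lemma join_edgeE x y : x != v -> y != v -> edge (x : J) y = edge x y.
Proof.
by move=> xv yv; rewrite /= /join_edge (negPf xv) (negPf yv) andbF orbF.
Qed.

(** The old neighbours of [v] lie in [D], and those that survive lie in [B]; so the new rim of [v]
    is exactly [B]. *)
Lemma join_edge_center y : y \in R -> edge (v : J) y = (y \in B).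
Proof.
rewrite inR /= /join_edge eqxx (negPf vB) andbF orbF /= eq_sym.
have [->|yv] /= := eqVneq y v; first by rewrite edge_irr (negPf vB).
rewrite inI negb_and negbK => yI.
have [yB|yB] := boolP (y \in B); first by rewrite orbT.
rewrite orbF (negPf yB) /= in yI *; apply: contraNF yI.
by apply: nbhd_interior; rewrite inI vB.
Qed.

Lemma emb_join (A : {set K}) : v \notin A -> emb (id : K -> J) A.
Proof.
move=> vA; split=> // x y xA yA; apply: join_edgeE.
  by apply: contraNneq vA => <-.
by apply: contraNneq vA => <-.
Qed.

(** The map [r] sends the interior to [v] and fixes the rest. It carries each edge to an edge or to
    the single point [v], so it preserves connectedness. *)
Lemma conn_collapse (A : {set K}) i : i \in A -> i \in I ->
  conn A -> @conn J (v |: (A :\: I)).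
Proof.
move=> iA iI cA X x xA Xx XE.
pose r t : J := if t \in I then v else t.
have rI t : t \in I -> r t = v by rewrite /r => ->.
have rNI t : t \notin I -> r t = t by rewrite /r => /negPf->.
have inN t : t \in A -> t \notin I -> t \in (v |: (A :\: I) : {set J}).
  by move=> tA tI; rewrite !inE -inI tI tA orbT.
have vN : v \in (v |: (A :\: I) : {set J}) by rewrite !inE eqxx.
have vI : v \in I by rewrite inI vB.
have nIv t : t \notin I -> t != v by apply: contraNneq => ->.
have JvE s t : t \in A -> s \in I -> t \notin I -> edge s t -> edge (v : J) t.
  move=> tA sI tI st; have tD := nbhd_interior sI st.
  rewrite join_edge_center ?inR ?tI ?orbT //.
  by move: tI; rewrite inI tD andbT negbK.
have [t0 t0A Xt0] : exists2 t, t \in A & X (r t).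
  move: xA; rewrite in_setU1 => /orP[/eqP xv|/setDP[xA xI]].
    by exists i; rewrite // rI // -xv.
  by exists x; rewrite // rNI.
have XA : {in A, forall t, X (r t)}.
  apply: (cA (fun t => X (r t)) t0) => // s t sA tA + st.
  have [sI|sI] := boolP (s \in I); have [tI|tI] := boolP (t \in I).
  - by rewrite !rI.
  - rewrite rI // rNI // => Xv; apply: (XE v) => //; first exact: inN.
    exact: JvE st.
  - rewrite rNI // rI // => Xs; apply: (XE s) => //; first exact: inN.
    by rewrite edgeC; apply: (JvE t) => //; rewrite edgeC.
  - rewrite !rNI // => Xs; apply: (XE s); rewrite ?inN //.
    by rewrite join_edgeE ?nIv.
move=> t; rewrite in_setU1 => /orP[/eqP->|/setDP[tA tI]].
  by rewrite -(rI i iI); apply: XA.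
by rewrite -(rNI t tI); apply: XA.
Qed.

(** The ends [e], [e'] of the path O(x) within [D] lie in [B]: an interior point keeps both its
    neighbours on O(x), so it cannot be an end. They are thus the two neighbours of [x] on [B], and
    the points [f], [f'] next to them on the path are interior. *)
Lemma boundary_ends x : x \in B -> exists e f e' f',
  [/\ [/\ e \in B, edge x e, f \in I, edge x f & edge e f],
      [/\ e' \in B, edge x e', f' \in I, edge x f' & edge e' f'],
      e != e' /\ ~~ edge e e',
      (forall c, c \in D -> edge x c -> edge e c -> c = f)
      /\ (forall c, c \in D -> edge x c -> edge e' c -> c = f')
    & forall c, c \in B -> edge x c -> c = e \/ c = e'].
Proof.
move=> xB; have [_ _ _ [/(_ x xB)/disk1_ends[e [e' [eP e'P ee' pe pe']]] _] cB] := dD.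
have notI d : d \in D :&: nbhd x -> pendant (D :&: nbhd x) d -> d \in B.
  move=> /setIP[dD' xd] [f [_ _ fE]]; apply: contraTT isT => dB.
  have dI : d \in I by rewrite inI dB.
  have [_ _ /(_ d xd)[a [b [[xa xb] ab _ [da db] _]]]] := cN x.
  have aE : a = f by apply: fE; rewrite // in_setI xa (nbhd_interior dI da).
  have bE : b = f by apply: fE; rewrite // in_setI xb (nbhd_interior dI db).
  by rewrite aE bE eqxx in ab.
have eB := notI _ eP pe; have e'B := notI _ e'P pe'.
move: eP e'P; rewrite !inE => /andP[_ xe] /andP[_ xe'].
have [_ _ /(_ x xB)[s [s' [_ _ nss' _ sE]]]] := cB.
have nee' : ~~ edge e e'.
  have := sE e eB xe; have := sE e' e'B xe' => -[]-> []->; rewrite ?edge_irr //.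
  by rewrite edgeC.
have BE c : c \in B -> edge x c -> c = e \/ c = e'.
  move=> cB' xc; have := sE e eB xe; have := sE e' e'B xe'; have := sE c cB' xc.
  move=> []-> []e1 []e2; move: ee'; rewrite e1 e2 ?eqxx // => _;
  by [left|right].
have [f [/setIP[fD xf] ef fE]] := pe; have [f' [/setIP[f'D xf'] e'f' f'E]] := pe'.
rewrite in_nbhd in xf; rewrite in_nbhd in xf'.
exists e, f, e', f'; split=> //.
- split=> //; rewrite inI fD andbT; apply/negP=> fB.
  by case: (BE f fB xf) => fe; move: ef; rewrite fe ?edge_irr // (negPf nee').
- split=> //; rewrite inI f'D andbT; apply/negP=> fB.
  case: (BE f' fB xf') => fe; move: e'f'; rewrite fe ?edge_irr //.
  by rewrite edgeC (negPf nee').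
- by split=> c cD xc ec; [apply: fE|apply: f'E]; rewrite // !inE cD.
Qed.

(** On the circle O(x) the point [e] has a second neighbour [g] besides [f]; it is outside [D],
    where [f] was the only choice. *)
Lemma outer_link x e f : edge x e -> edge x f -> edge e f ->
    (forall c, c \in D -> edge x c -> edge e c -> c = f) ->
  exists g, [/\ g \notin D, edge x g, edge e g &
    forall c, edge x c -> edge e c -> c = f \/ c = g].
Proof.
move=> xe xf ef fE.
have [g] : exists g, nbr_pair (nbhd x) e f g by apply: (nbr_pair_at (cN x)); rewrite ?in_nbhd.
rewrite /nbr_pair !in_nbhd => -[[_ xg] fg _ [_ eg] E].
exists g; split=> // [|c xc]; last by apply: E; rewrite in_nbhd.
by apply: contraNN fg => gD; rewrite (fE g).
Qed.

Lemma exists_outside : exists w, w \notin D.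
Proof.
have [_ _ _ _ [[x xB] _ _]] := dD.
have [e [f [_ [_ [[_ xe _ xf ef] _ _ [fE _] _]]]]] := boundary_ends xB.
by have [w [wD _ _ _]] := outer_link xe xf ef fE; exists w.
Qed.

(** Shrinking replaces the inner part of O(x) by the single point [v], which closes the outer arc
    from [e] to [e'] to a circle. *)
Lemma shrink_rim_boundary x : x \in B ->
  @circle J (v |: (nbhd x :\: I)).
Proof.
move=> xB; have [e [f [e' [f' [[eB xe fI xf ef] [e'B xe' f'I xf' e'f'] [ee' nee'] [fE f'E] BE]]]]] := boundary_ends xB.
set N : {set J} := v |: _.
have vI : v \in I by rewrite inI vB.
have nIv t : t \notin I -> t != v by apply: contraNneq => ->.
have inN t : (t \in N) = (t == v) || edge x t && (t \notin I).
  by rewrite !inE -inI andbC.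
have BI t : t \in B -> t \notin I by move=> tB; rewrite inI tB.
have BN t : t \in B -> edge x t -> t \in N.
  by move=> tB xt; rewrite inN xt BI ?orbT.
have NR t : t \in N -> t \in R by rewrite inN inR => /orP[->|/andP[_ ->]] //; rewrite orbT.
have vN : v \in N by rewrite inN eqxx.
have [_ cx tx] := cN x.
split; first by exists v.
  by apply: (@conn_collapse _ f) => //; rewrite in_nbhd.
(* At an end [d] of the outer arc, [v] takes the place of the interior neighbour [h], and the outer
   neighbour [g] stays. *)
have end_nbr_pair d h : d \in B -> edge x d -> h \in I -> edge x h -> edge d h ->
    (forall c, c \in D -> edge x c -> edge d c -> c = h) ->
    exists a b, @nbr_pair J N d a b.
  move=> dB xd hI xh dh hE.
  have [g [gD xg dg gE]] := outer_link xd xh dh hE.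
  have gI : g \notin I by rewrite inI negb_and gD orbT.
  have gB : g \notin B by apply: contra gD; apply: BD.
  have gN : g \in N by rewrite inN xg gI orbT.
  have dv : edge (d : J) v by rewrite edgeC join_edge_center // NR // BN.
  exists v, g; split=> //.
  - by rewrite eq_sym nIv.
  - by rewrite join_edge_center // NR.
  - by split; rewrite // join_edgeE // nIv // BI.
  move=> c cN'; have [->|cv] := eqVneq c v; first by left.
  move: cN'; rewrite inN (negPf cv) => /andP[xc cI].
  rewrite join_edgeE ?(nIv _ (BI _ dB)) // => dc; case: (gE c xc dc) => ch; last by right.
  by rewrite ch hI in cI.
move=> y yN; have [->|yv] := eqVneq y v.
  exists e, e'; split=> //.
  - by split; apply: BN.
  - by rewrite join_edgeE // nIv // BI.
  - by rewrite !join_edge_center // NR // BN.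
  move=> c cN'; rewrite join_edge_center ?NR // => cB; apply: BE => //.
  by move: cN'; rewrite inN => /orP[/eqP cv|/andP[]//]; rewrite cv (negPf vB) in cB.
move: (yN); rewrite inN (negPf yv) => /andP[xy yI].
have [yB|yB] := boolP (y \in B).
  case: (BE y yB xy) => ->; first exact: (end_nbr_pair e f eB xe fI xf ef fE).
  exact: (end_nbr_pair e' f' e'B xe' f'I xf' e'f' f'E).
have yD : y \notin D by move: yI; rewrite inI yB.
have [a [b]] := tx y (etrans (in_nbhd _ _) xy).
rewrite /nbr_pair !in_nbhd => -[[xa xb] ab nab [ya yb] E].
have out (t : K) : @edge K y t -> t \notin I.
  by move=> yt; apply: contra yD => tI; apply: nbhd_interior tI _; rewrite edgeC.
exists a, b; split=> //.
- by rewrite !inN xa xb !out // !orbT.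
- by rewrite join_edgeE // nIv // out.
- by rewrite !join_edgeE // nIv // out.
move=> c cN'; have [->|cv] := eqVneq c v.
  by rewrite edgeC join_edge_center ?NR // (negPf yB).
rewrite join_edgeE // => yc; apply: E => //.
by move: cN'; rewrite inN (negPf cv) in_nbhd => /andP[].
Qed.

(** There are three kinds of surviving points: [v], whose rim becomes [B]; points of [B]; and points
    outside [D], which see no interior point and keep their rims. *)
Lemma shrink_circle (x : J) : x \in R -> @circle J (R :&: @nbhd J x).
Proof.
move=> xR; have [xv|xv] := eqVneq x v.
  rewrite xv; have -> : R :&: @nbhd J v = (id : K -> J) @: B.
    rewrite imset_id; apply/setP=> y; apply/setIP/idP => [[yR]|yB].
      by rewrite in_nbhd join_edge_center.
    have yR : y \in R by rewrite inR inI yB orbT.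
    by rewrite in_nbhd join_edge_center.
  by apply/(circle_emb (emb_join vB)); case: dD.
have xI : x \notin I by move: xR; rewrite inR (negPf xv).
have [xB|xB] := boolP (x \in B).
  suff -> : R :&: @nbhd J x = v |: (@nbhd K x :\: I) by apply: shrink_rim_boundary.
  apply/setP=> y; rewrite in_setI in_setU1 in_setD inR !in_nbhd.
  have [->|yv] := eqVneq y v; last by rewrite join_edgeE // -(@in_nbhd K).
  by rewrite edgeC join_edge_center.
have xD : x \notin D by move: xI; rewrite inI xB.
have out (t : K) : @edge K x t -> t \notin I.
  by move=> xt; apply: contra xD => tI; apply: nbhd_interior tI _; rewrite edgeC.
have vNx : v \notin @nbhd K x.
  by rewrite in_nbhd; apply/negP=> /out; rewrite inI vB vD.
have -> : R :&: @nbhd J x = (id : K -> J) @: @nbhd K x.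
  rewrite imset_id; apply/setP=> y; rewrite in_setI inR !in_nbhd.
  have [->|yv] := eqVneq y v.
    by rewrite edgeC join_edge_center // (negPf xB) (negPf vNx).
  rewrite join_edgeE // -(@in_nbhd K); apply: andb_idl => xy.
  by apply: out; rewrite -in_nbhd.
exact/(circle_emb (emb_join vNx)).
Qed.

Lemma shrink_manifold : manifold2 (induced R).
Proof.
have vR : v \in R by rewrite inR eqxx.
have vI : v \in I by rewrite inI vB.
apply/manifold2P; split; first by exists (pt vR).
  apply/(conn_emb (emb_val _)); rewrite imset_val.
  have -> : R = v |: (setT :\: I).
    by apply/setP=> y; rewrite inR in_setU1 !inE !andbT.
  by apply: (conn_collapse (in_setT v) vI); case/manifold2P: mK.
move=> x; apply/(circle_emb (emb_val _)).
rewrite -[_ @: _]/(ambient (nbhd x)) ambient_nbhd; apply: shrink_circle.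
exact: (valP x).
Qed.

(** [CT_glue] is applied to [D] and to the points other than [w] outside the interior. The cone
    point over [D] meets the latter exactly in [B], as [v] does after the shrinking; hence [f] sends
    [v] to [None]. *)
Lemma shrink_CT w : w \notin D -> CT (R :\ w) -> CT [set~ w].
Proof.
move=> wD cR; pose Y := ~: I :\ w.
have vI : v \in I by rewrite inI vB.
have inY x : (x \in Y) = (x != w) && (x \notin I) by rewrite in_setD1 in_setC.
have -> : [set~ w] = D :|: Y.
  apply/setP=> x; rewrite in_setU inY inI !inE.
  have [->|_] /= := eqVneq x w; first by rewrite (negPf wD).
  by case: (x \in D) => //=; rewrite andbF.
have wv : w != v by apply: contraNneq wD => ->.
apply: CT_glue.
- move=> x y xD; rewrite !inY => xY /andP[yw yI] yD.
  have xI : x \in I.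
    by move: xY; rewrite negb_and !negbK => /orP[/eqP xw|//]; rewrite xw (negPf wD) in xD.
  by apply: contra yD; apply: nbhd_interior.
- by case: dD => -[].
pose f (x : J) : add_vertex D := if x == v then None else Some x.
have fv : f v = None by rewrite /f eqxx.
have fNv x : x != v -> f x = Some x by rewrite /f => /negPf->.
have <- : f @: (R :\ w) = None |: Some @: Y.
  apply/setP=> p; apply/imsetP/setU1P => [[x]|[->|/imsetP[x]]].
  - rewrite in_setD1 inR => /andP[xw xR ->].
    have [->|xv] := eqVneq x v; first by rewrite fv; left.
    by right; rewrite fNv // imset_f // inY xw; rewrite (negPf xv) in xR.
  - by exists v; rewrite // in_setD1 inR eqxx eq_sym wv.
  - rewrite inY => /andP[xw xI] ->.
    have xv : x != v by apply: contraNneq xI => ->.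
    by exists x; rewrite ?fNv // in_setD1 xw inR xI orbT.
have DB x : x \in R -> x != v -> (x \in D) = (x \in B).
  rewrite inR inI => /orP[->//|xI _]; move: xI.
  by have [/BD ->|_ /= /negPf->] := boolP (x \in B).
suff fE : emb f (R :\ w) by apply/(CT_emb fE).
split=> [x y _ _|x y].
  have [->|xv] := eqVneq x v; have [->|yv] := eqVneq y v => //;
  by rewrite ?fv ?fNv // => -[].
rewrite !in_setD1 => /andP[_ xR] /andP[_ yR].
have [->|xv] := eqVneq x v; have [->|yv] := eqVneq y v.
- by rewrite fv !edge_irr.
- by rewrite fv fNv // join_edge_center // -DB.
- by rewrite fv fNv // [RHS]edgeC join_edge_center // -DB.
by rewrite !fNv // join_edgeE.
Qed.

End Shrink.

(** * Induction on the number of points *)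

Lemma ambientC (G : graph) (D : {set G}) (B : {set induced D}) :
  ambient (~: B) = D :\: ambient B.
Proof.
apply/setP=> y; rewrite in_setD; apply/imsetP/andP => [[x]|[yB yD]].
  rewrite inE => xB ->; split; last exact: (valP x).
  by apply: contra xB => /imsetP[z zB /val_inj->].
exists (pt yD) => //; rewrite inE; apply: contra yB => yB.
by rewrite -[y]/(val (pt yD)); apply: imset_f.
Qed.

(** [obtainable] grows at its far end, while the induction puts a shrinking in front. *)
Lemma obtainable_cons (K L M : graph) :
  d_transform K L -> obtainable L M -> obtainable K M.
Proof.
move=> KL; elim=> {M} [M LM|M N P _ KM MN NP].
  by apply: obtainable_step KL LM; apply: obtainable_iso; exists id; split=> //; exists id.
exact: obtainable_step KM MN NP.
Qed.

Definition circles_bound (K : graph) : Prop :=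
  forall S : {set K}, sphere1 (induced S) ->
    exists (D : {set K}) (B : {set induced D}), disk2 B /\ ambient B = S.

Lemma unshrinkable_CT (K : graph) : manifold2 K -> circles_bound K ->
    (forall D B : {set K}, disk D B -> #|D :\: B| <= 1) ->
  exists x : K, CT [set~ x].
Proof.
move=> mK fK small.
have [|u v uv|v [y [vy Nvy]]] := @exists_twins K mK; last 1 first.
- by exists v; apply: twin_CT vy Nvy.
(* By [small], the disk bounded by [S] has one interior point [w]. Minimality identifies the rim of
   [w] in the disk first with [S], then with O(w). *)
- move=> S cS; have [|D [B' [/disk2_ambient dD BS]]] := fK S.
    exact/sphere1_induced.
  rewrite BS in dD; have [_ SD [w wI] [_ ci] _] := dD.
  exists w; move: (wI) => /setDP[wD wS].
  have Dw : D = w |: S.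
    apply/eqP; rewrite eqEsubset subUset sub1set wD SD !andbT.
    apply/subsetP=> t tD; rewrite in_setU1 orbC.
    have [//|tS] /= := boolP (t \in S).
    have /card_le1_eqP/(_ t w) := small D S dD; rewrite in_setD tS tD.
    by move=> /(_ isT wI)->.
  have := ci w wD wS; have -> : D :&: nbhd w = S :&: nbhd w.
    apply/setP=> t; rewrite Dw !inE; have [->|] //= := eqVneq t w.
    by rewrite edge_irr !andbF.
  move=> cSw; have [[s sS] _ tS] := cSw.
  have SN : S :&: nbhd w = S.
    apply: circle_minimal cS (subsetIl _ _) sS _ => t /tS[a [b]].
    by case=> -[? ?] ? _ [? ?] _; exists a, b.
  have cN : circle (nbhd w) by case/manifold2P: mK.
  rewrite -SN; symmetry.
  apply: circle_minimal cN (subsetIr _ _) sS _ => t /tS[a [b]].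
  by case=> -[? ?] ? _ [? ?] _; exists a, b.
have [/existsP[p /existsP[q /and3P[/and3P[? ? ?] /and3P[? ? ?] ?]]]|no4] := boolP
    [exists p, exists q, [&& [&& edge u p, p != v & ~~ edge v p],
      [&& edge v q, q != u & ~~ edge u q] & edge p q]].
  by exists p, q.
have sf : square_free u v.
  move=> p q up pv nvp vq qu nuq; apply: contra no4 => pq.
  by apply/existsP; exists p; apply/existsP; exists q; rewrite up pv nvp vq qu nuq.
(* Both [u] and [v] are interior to this disk, so [small] would make them equal. *)
have := small _ _ (edge_ball_disk mK uv sf) => /card_le1_eqP/(_ u v).
rewrite !inE !eqxx uv (edgeC v) uv !andbF !orbT /= => /(_ isT isT) e.
by rewrite e edge_irr in uv.
Qed.

(** The hypothesis concerns every manifold obtainable from [K], so it passes on to the shrunken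
    graph, which has fewer points. *)
Lemma circles_bound_CT (n : nat) (K : graph) : #|K| < n -> manifold2 K ->
    (forall M, manifold2 M -> obtainable K M -> circles_bound M) ->
  exists x : K, CT [set~ x].
Proof.
elim: n K => // n IH K ltn mK fK.
have fK0 : circles_bound K.
  by apply: fK => //; apply: obtainable_iso; exists id; split=> //; exists id.
case: (classic (exists D B : {set K}, disk D B /\ 1 < #|D :\: B|)); last first.
  move=> no; apply: unshrinkable_CT => // D B dD; rewrite leqNgt; apply/negP=> lt.
  by apply: no; exists D, B.
move=> [D [B [dD lt1]]].
have [v] : exists v, v \in D :\: B by case: dD.
move=> vI; have /setDP[vD vB] := vI.
have BD : B \subset D by case: dD.
have KK' : d_transform K (induced (~: ((D :\: B) :\ v) : {set join v B})).
  have := @d_shrink K D [set x : induced D | val x \in B] v.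
  rewrite /shrink_disk ambientC ambient_preim //.
  by apply=> //; apply: disk_disk2.
have mK' := shrink_manifold mK dD vD vB.
(* The point to be deleted is chosen outside [D], so that it survives the shrinking and can be
   deleted on both sides. *)
have [w wD] := exists_outside mK dD.
have wR : w \in (~: ((D :\: B) :\ v) : {set join v B}).
  by rewrite !inE (negPf wD) !andbF.
exists w; apply: (shrink_CT mK dD vD vB wD).
have := ambient_del (pt wR); rewrite /= => <-; apply/CT_ambient.
(* The induction hypothesis gives some point [x] of the shrunken manifold; [CT_del_all] moves the
   puncture from [x] to [w]. *)
have [|M mM KM|x cx] := IH _ _ mK'; last exact: CT_del_all cx.
- rewrite card_induced -ltnS; apply: leq_trans ltn.
  rewrite ltnS -(cardsC ((D :\: B) :\ v)) -add1n leq_add2r.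
  by rewrite (cardsD1 v) vI in lt1.
- by apply: fK => //; apply: obtainable_cons KM.
Qed.

Theorem theorem8p1 (H : graph) (hH : manifold2 H)
  (hS : forall K : graph, manifold2 K -> equivalent H K ->
     forall S : {set K}, sphere1 (induced S) ->
       exists (D : {set K}) (B : {set induced D}), disk2 B /\ ambient B = S) :
  sphere2 H.
Proof.
have [|x cx] := circles_bound_CT (leqnn #|H|.+1) hH; last exact: CT_del_sphere2 cx.
by move=> M mM HM; apply: hS => //; left.
Qed.
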